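(* Let $D=\{(x,y)\in\mathbb{R}^2 \mid x^2+y^2\le 1\}$ with $\omega=dx\wedge dy$, let $G=\mathrm{Symp}(D)$, let $\widetilde{G}$ be its universal covering group (for the $C^\infty$-topology) and $p:\widetilde{G}\to G$ the projection. Then \[ p^*\overline{\tau}+2R=\pi^2\,\widetilde{\mathrm{rot}} \quad\text{as maps } \widetilde{G}\to\mathbb{R}, \] where $\widetilde{\mathrm{rot}}:\widetilde{G}\to\mathbb{R}$ is the pullback of Poincaré's translation number by the surjection $\widetilde{G}\to\widetilde{\mathrm{Diff}_+(S^1)}$ induced by restriction to the boundary.
   Context: $G=\mathrm{Symp}(D)$ is the group of all symplectomorphisms of $D$ (not necessarily the identity on $\partial D$). For a $1$-form $\eta$ on $D$ with $d\eta=\omega$, define $\tau_\eta:G\to\mathbb{R}$ by $\tau_\eta(g)=\int_D g^*\eta\wedge\eta$. Each $\tau_\eta$ is a quasi-morphism and its homogenization $\overline{\tau}(g)=\lim_{n\to\infty}\tau_\eta(g^n)/n$ is independent of $\eta$. For a path $g_t$ in $G$ with $g_0=\mathrm{id}$, let $X_t=(\partial g_t/\partial t)\circ g_t^{-1}$ (a divergence-free vector field tangent to $\partial D$), and let $f_{X_t}:D\to\mathbb{R}$ be the unique function with $i_{X_t}\omega=df_{X_t}$ and $f_{X_t}|_{\partial D}=0$. Then $R:\widetilde{G}\to\mathbb{R}$, $R([g_t])=\int_0^1\left(\int_D f_{X_t}\omega\right)dt$, is a well-defined homomorphism. Identify $S^1=\partial D$ with $\mathbb{R}/2\pi\mathbb{Z}$;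 elements of $\widetilde{\mathrm{Diff}_+(S^1)}$ are viewed as diffeomorphisms $\widetilde{\varphi}$ of $\mathbb{R}$ with $\widetilde{\varphi}(\theta+2\pi)=\widetilde{\varphi}(\theta)+2\pi$, and the translation number is $\widetilde{\mathrm{rot}}(\widetilde{\varphi})=\lim_{n\to\infty}\widetilde{\varphi}^n(0)/(2\pi n)$. *)

(* Defs.v *)
From Stdlib Require Import Reals List.
From Coquelicot Require Import Coquelicot.
Open Scope R_scope.

Inductive dir3 := Dt | Dx | Dy.

Fixpoint pd3 (l : list dir3) (F : R -> R -> R -> R) : R -> R -> R -> R :=
  match l with
  | nil => F
  | d :: l' =>
      let G := pd3 l' F in
      match d with
      | Dt => fun t x y => Derive (fun s => G s x y) t
      | Dx => fun t x y => Derive (fun s => G t s y) x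
      | Dy => fun t x y => Derive (fun s => G t x s) y
      end
  end.

Definition smooth3 (F : R -> R -> R -> R) : Prop :=
  forall l : list dir3,
    (forall t x y,
        ex_derive (fun s => pd3 l F s x y) t /\
        ex_derive (fun s => pd3 l F t s y) x /\
        ex_derive (fun s => pd3 l F t x s) y) /\
    (forall t x y,
        continuous (fun p : R * R * R => pd3 l F (fst (fst p)) (snd (fst p)) (snd p))
                   (t, x, y)).

Definition smooth2 (f : R -> R -> R) : Prop := smooth3 (fun _ x y => f x y).

(** A map R^2 -> R^2 with C^infinity components (used as a smooth extension
    of a map defined on the closed disk). *)
Definition smooth_map (g : R * R -> R * R) : Prop :=
  smooth2 (fun x y => fst (g (x, y))) /\ smooth2 (fun x y => snd (g (x, y))).

Definition inD (p : R * R) : Prop := fst p ^ 2 + snd p ^ 2 <= 1.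
Definition onS1 (p : R * R) : Prop := fst p ^ 2 + snd p ^ 2 = 1.

Definition dx (h : R * R -> R) (p : R * R) : R := Derive (fun s => h (s, snd p)) (fst p).
Definition dy (h : R * R -> R) (p : R * R) : R := Derive (fun s => h (fst p, s)) (snd p).

Definition comp1 (g : R * R -> R * R) : R * R -> R := fun q => fst (g q).
Definition comp2 (g : R * R -> R * R) : R * R -> R := fun q => snd (g q).

Definition jac_det (g : R * R -> R * R) (p : R * R) : R :=
  dx (comp1 g) p * dy (comp2 g) p - dy (comp1 g) p * dx (comp2 g) p.

Definition is_symp (g : R * R -> R * R) : Prop :=
  smooth_map g /\
  (forall p, inD p -> inD (g p)) /\
  (exists h : R * R -> R * R,
      smooth_map h /\
      forall p, inD p -> inD (h p) /\ h (g p) = p /\ g (h p) = p) /\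
  (forall p, inD p -> jac_det g p = 1).

Definition int_D (f : R * R -> R) : R :=
  RInt (fun x => RInt (fun y => f (x, y)) (- sqrt (1 - x ^ 2)) (sqrt (1 - x ^ 2))) (-1) 1.

(** eta = a dx + b dy is a smooth 1-form with d eta = omega on D. *)
Definition is_primitive_omega (a b : R * R -> R) : Prop :=
  smooth2 (fun x y => a (x, y)) /\ smooth2 (fun x y => b (x, y)) /\
  forall p, inD p -> dx b p - dy a p = 1.

(** tau_eta(g) = int_D g^* eta /\ eta, with eta = a dx + b dy.
    g^* eta = P dx + Q dy, and (P dx + Q dy) /\ (a dx + b dy) = (P b - Q a) dx /\ dy. *)
Definition tau (a b : R * R -> R) (g : R * R -> R * R) : R :=
  int_D (fun p =>
    let P := a (g p) * dx (comp1 g) p + b (g p) * dx (comp2 g) p in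
    let Q := a (g p) * dy (comp1 g) p + b (g p) * dy (comp2 g) p in
    P * b p - Q * a p).

(** A smooth path (isotopy) g_t, t in [0,1], in Symp(D) starting at the
    identity; it represents an element [g_t] of the universal cover. *)
Definition is_symp_isotopy (F : R -> R * R -> R * R) : Prop :=
  smooth3 (fun t x y => fst (F t (x, y))) /\
  smooth3 (fun t x y => snd (F t (x, y))) /\
  (forall p, inD p -> F 0 p = p) /\
  (forall t, 0 <= t <= 1 -> is_symp (F t)).

(** H t = f_{X_t}: i_{X_t} omega = d(H t), H t = 0 on the boundary, where
    X_t = (d/dt g_t) o g_t^{-1}, i.e. X_t (g_t q) = d/dt g_t (q).
    Since i_X (dx/\dy) = X1 dy - X2 dx: dx (H t) = - X2, dy (H t) = X1. *)
Definition is_normalized_hamiltonian (F : R -> R * R -> R * R)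
    (H : R -> R * R -> R) : Prop :=
  forall t, 0 <= t <= 1 ->
    smooth2 (fun x y => H t (x, y)) /\
    (forall p, onS1 p -> H t p = 0) /\
    (forall q, inD q ->
        dx (H t) (F t q) = - Derive (fun s => snd (F s q)) t /\
        dy (H t) (F t q) = Derive (fun s => fst (F s q)) t).

Definition Rcal (H : R -> R * R -> R) : R := RInt (fun t => int_D (H t)) 0 1.

(** Phi is the continuous lift (in angle coordinates, S^1 = R/2piZ) of the
    boundary isotopy g_t|_{dD}, starting at the identity; Phi 1 is the image
    of [g_t] in the universal cover of Diff_+(S^1). *)
Definition is_boundary_lift (F : R -> R * R -> R * R) (Phi : R -> R -> R) : Prop :=
  (forall t th, continuous (fun p : R * R => Phi (fst p) (snd p)) (t, th)) /\
  (forall th, Phi 0 th = th) /\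
  (forall t th, 0 <= t <= 1 -> F t (cos th, sin th) = (cos (Phi t th), sin (Phi t th))).

(* Main.v *)
Require Import Defs.
From Stdlib Require Import Reals List ZArith Lra Lia Psatz ClassicalEpsilon FunctionalExtensionality.
From Coquelicot Require Import Coquelicot.
Open Scope R_scope.

(** Write [g = F 1] and [G_t = F t o g^n]. By Cartan's formula [d/dt G_t^* eta = dK_t] with
    [K_t = G_t^* (H_t + eta (X_t))], so Stokes gives
    [d/dt tau (G_t) = oint K_t eta - int_D K_t omega]. The last integral is [2 int_D H_t], because
    [G_t] preserves area and [eta (X_t) omega = eta /\ dH_t]. On the boundary [K_t = eta (X_t)],
    whose time integral is [C (Phi_1 th) - C (th)] for a primitive [C] of [c], where
    [eta = c dth] on the circle. Telescoping over the iterates,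
    [tau (g^n) = - 2 n R + int (C (Phi_1^n th) - C (th)) c dth].
    As [c] has integral [PI] over the circle, [C] is [th / 2] up to a periodic function, and the
    boundary term grows like [PI / 2 * Phi_1^n (0)], that is, like [n PI^2 rho]. *)

(** * Parametric integrals and the chain rule *)

(** The hypotheses are uneven, and this shapes the proof. The maps [F t] are smooth on the whole
    plane, but start at the identity, preserve area and have inverses only on D; [H] is smooth in
    space with no regularity stated in t; [Phi] is merely continuous. Double integrals are therefore
    handled through Green's formula, which replaces [int_D] by a circle integral over the fixed
    interval [0, 2 PI]: linearity, differentiation in t and invariance under area-preserving maps
    are all read off there. Integrability of the space integral of [H t] comes out of the variation
    formula itself, and differentiability of the lift along a trajectory from the equation for its
    angular velocity. Swapping time and angle integrals is done by differentiating in the upper time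
    limit. The form c enters the constant twice: its mean PI / (2 PI) is the slope 1/2 of C, and its
    total mass PI weights the boundary integral. The remaining factor 2 PI converts angles to turns,
    and 1/2 * PI * 2 PI = PI^2. *)

Lemma caratheodory (f : R -> R) (s l : R) :
  is_derive f s l <->
  exists sigma : R -> R,
    continuous sigma s /\ sigma s = l /\
    forall r, f r - f s = sigma r * (r - s).
Proof.
  split.
  - intros Hf. apply is_derive_Reals in Hf.
    (* The difference quotient with its removable point filled in. Differentiability as a continuous
       factor turns the chain rule in several variables into algebra of continuous functions. *)
    exists (fun r => if Req_EM_T r s then l else (f r - f s) / (r - s)).
    split; [|split].
    + apply continuity_pt_filterlim. intros eps Heps.
      destruct (Hf eps Heps) as [d Hd].
      exists d. split; [apply cond_pos|]. simpl Base. intros x [[_ Hx] Hdist].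
      destruct (Req_EM_T s s) as [_|n]; [|now elim n].
      destruct (Req_EM_T x s) as [e|n].
      * simpl. unfold Rdist. rewrite Rminus_diag, Rabs_R0. exact Heps.
      * assert (Hxs : x - s <> 0) by (intros e; apply n; apply Rminus_diag_uniq, e).
        specialize (Hd (x - s) Hxs Hdist).
        replace (s + (x - s)) with x in Hd by ring. exact Hd.
    + destruct (Req_EM_T s s) as [_|n]; [reflexivity|now elim n].
    + intros r. destruct (Req_EM_T r s) as [e|n]; [subst; ring|field; lra].
  - intros [sg [Hc [Hs He]]]. apply is_derive_Reals.
    intros eps Heps. apply continuity_pt_filterlim in Hc.
    destruct (Hc eps Heps) as [d [Hd Hc']].
    exists (mkposreal d Hd). intros h Hh0 Hh.
    replace ((f (s + h) - f s) / h) with (sg (s + h)).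
    2:{ rewrite He. field. exact Hh0. }
    rewrite <- Hs. apply Hc'. split.
    + split; [exact I|lra].
    + simpl. unfold Rdist. replace (s + h - s) with h by ring. exact Hh.
Qed.

(** The parameter lives in an arbitrary uniform space so that single reals, pairs and triples are
    covered at once. Compactness of [a, b] makes the pointwise moduli uniform. *)
Lemma continuous_RInt_fiber {U : UniformSpace} (k : R -> U -> R) (a b : R) (p : U) :
  a <= b ->
  (forall t q, continuous (fun z : R * U => k (fst z) (snd z)) (t, q)) ->
  continuous (fun q => RInt (fun t => k t q) a b) p.
Proof.
  intros Hab Hk.
  assert (Hint : forall q, ex_RInt (fun t => k t q) a b).
  { intros q. apply (ex_RInt_continuous (V := R_CompleteNormedModule)).
    intros z _.
    apply (continuous_comp_2 (fun t : R => t) (fun _ => q) k z);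
      [apply continuous_id|apply continuous_const|apply Hk]. }
  apply filterlim_locally. intros eps.
  (* The [+ 1] keeps the denominator positive when a = b. Going through the value at t uses [e]
     twice, which costs at most eps / 2 after integration. *)
  assert (He' : 0 < eps / (b - a + 1) / 4).
  { apply Rdiv_lt_0_compat; [|lra].
    apply Rdiv_lt_0_compat; [apply cond_pos|lra]. }
  set (e := mkposreal _ He').
  assert (Hdl : forall t, exists d : posreal, forall u q,
             Rabs (u - t) < d -> ball p d q -> Rabs (k u q - k t p) < e).
  { intros t. destruct (proj1 (filterlim_locally _ _) (Hk t p) e) as [d Hd].
    exists d. intros u q Hu Hq. apply (Hd (u, q)). split; [exact Hu|exact Hq]. }
  set (delta := fun t => proj1_sig (constructive_indefinite_description _ (Hdl t))).
  assert (Hdelta := fun t => proj2_sig (constructive_indefinite_description _ (Hdl t))).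
  destruct (compactness_value_1d a b delta) as [d Hd].
  exists d. intros q Hq.
  assert (Hu : forall u, a <= u <= b -> Rabs (k u q - k u p) <= 2 * e).
  (* The covering point is only available under a double negation, hence the argument by
     contradiction. *)
  { intros u Hu. apply Rnot_lt_le. intros Hlt.
    apply (Hd u Hu). intros [t [Ht [Hut Hdt]]].
    assert (H1 := Hdelta t u q Hut (ball_le p d (delta t) Hdt q Hq)).
    assert (H2 := Hdelta t u p Hut (ball_center p (delta t))).
    apply (Rlt_not_le _ _ Hlt).
    replace (k u q - k u p) with ((k u q - k t p) - (k u p - k t p)) by ring.
    eapply Rle_trans; [apply Rabs_triang|]. rewrite Rabs_Ropp. lra. }
  change (Rabs (RInt (fun t => k t q) a b - RInt (fun t => k t p) a b) < eps).
  assert (Hm : RInt (fun t => minus (k t q) (k t p)) a b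
               = RInt (fun t => k t q) a b - RInt (fun t => k t p) a b)
    by exact (RInt_minus (V := R_CompleteNormedModule) _ _ a b (Hint q) (Hint p)).
  rewrite <- Hm.
  eapply Rle_lt_trans.
  - apply (abs_RInt_le_const (fun t => minus (k t q) (k t p)) a b (2 * e) Hab).
    + apply (ex_RInt_minus (V := R_NormedModule)); apply Hint.
    + exact Hu.
  - simpl. assert (Hp := cond_pos eps).
    apply Rle_lt_trans with (eps / 2 * ((b - a) / (b - a + 1))).
    + right. field. lra.
    + assert ((b - a) / (b - a + 1) <= 1).
      { apply (Rmult_le_reg_r (b - a + 1)); [lra|].
        unfold Rdiv. rewrite Rmult_assoc, Rinv_l; lra. }
      assert (0 <= (b - a) / (b - a + 1)) by (apply Rdiv_le_0_compat; lra).
      nra.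
Qed.

(** A function of x and y alone enters as [fun _ => f], so static and time-dependent functions share
    one set of closure lemmas. *)
Definition cont3 (F : R -> R -> R -> R) : Prop :=
  forall t x y,
    continuous (fun p : R * R * R => F (fst (fst p)) (snd (fst p)) (snd p)) (t, x, y).

Lemma continuous_pair {U V W : UniformSpace} (f : U -> V) (g : U -> W) (p : U) :
  continuous f p -> continuous g p -> continuous (fun q => (f q, g q)) p.
Proof.
  intros Hf Hg. apply (continuous_comp_2 f g (fun v w => (v, w)) p Hf Hg).
  apply (continuous_ext (fun z => z)); [intros [v w]; reflexivity|apply continuous_id].
Qed.

Lemma cont3_comp {U : UniformSpace} (F : R -> R -> R -> R) (u v w : U -> R) (p : U) :
  cont3 F -> continuous u p -> continuous v p -> continuous w p ->
  continuous (fun q => F (u q) (v q) (w q)) p.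
Proof.
  intros HF Hu Hv Hw.
  apply (continuous_comp (fun q => (u q, v q, w q))
           (fun p : R * R * R => F (fst (fst p)) (snd (fst p)) (snd p))).
  - apply continuous_pair; [apply continuous_pair|]; assumption.
  - apply HF.
Qed.

Lemma cont3_freeze F t0 : cont3 F -> cont3 (fun _ => F t0).
Proof.
  intros HF t x y. apply (cont3_comp F (fun _ => t0)
    (fun p : R * R * R => snd (fst p)) (fun p => snd p) _ HF).
  - apply continuous_const.
  - apply (continuous_comp fst snd); [apply continuous_fst|apply continuous_snd].
  - apply continuous_snd.
Qed.

(* Hadamard: a difference quotient is the average of the derivative, and the
   average depends continuously on the parameters. *)
Lemma hadamard {U : UniformSpace} (phi dphi : R -> U -> R) (x0 : R) :
  (forall x q, is_derive (fun z => phi z q) x (dphi x q)) ->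
  (forall x q, continuous (fun z : R * U => dphi (fst z) (snd z)) (x, q)) ->
  exists m : R -> U -> R,
    (forall x q, continuous (fun z : R * U => m (fst z) (snd z)) (x, q)) /\
    (forall q, m x0 q = dphi x0 q) /\
    forall x q, phi x q - phi x0 q = m x q * (x - x0).
Proof.
  intros Hd Hc.
  exists (fun x q => RInt (fun tau => dphi (x0 + tau * (x - x0)) q) 0 1).
  split; [|split].
  - intros x q.
    apply (continuous_RInt_fiber (U := prod_UniformSpace R_UniformSpace U)
             (fun tau z => dphi (x0 + tau * (fst z - x0)) (snd z)) 0 1 (x, q)).
    + lra.
    + intros t z.
      apply (continuous_comp_2 (fun w : R * (R * U) => x0 + fst w * (fst (snd w) - x0))
               (fun w : R * (R * U) => snd (snd w)) dphi (t, z)).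
      * apply (continuous_plus (V := R_NormedModule)); [apply continuous_const|].
        apply (continuous_mult (K := R_AbsRing)); [apply continuous_fst|].
        apply (continuous_minus (V := R_NormedModule)); [|apply continuous_const].
        apply (continuous_comp snd fst); [apply continuous_snd|apply continuous_fst].
      * apply (continuous_comp snd snd); apply continuous_snd.
      * apply Hc.
  - intros q. rewrite (RInt_ext _ (fun _ => dphi x0 q)).
    + rewrite RInt_const. unfold scal; simpl; unfold mult; simpl. ring.
    + intros t _. f_equal. ring.
  - intros x q.
    assert (Hi : is_RInt (fun tau => dphi (x0 + tau * (x - x0)) q * (x - x0)) 0 1
                   (minus (phi (x0 + 1 * (x - x0)) q) (phi (x0 + 0 * (x - x0)) q))).
    { apply (is_RInt_derive (fun tau => phi (x0 + tau * (x - x0)) q)).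
      - intros tau _.
        replace (dphi (x0 + tau * (x - x0)) q * (x - x0))
          with (scal (x - x0) (dphi (x0 + tau * (x - x0)) q)).
        2:{ unfold scal; simpl; unfold mult; simpl. ring. }
        apply (is_derive_comp (fun z => phi z q) (fun tau => x0 + tau * (x - x0))).
        + apply Hd.
        + auto_derive; [exact I|ring].
      - intros tau _.
        apply (continuous_mult (K := R_AbsRing)); [|apply continuous_const].
        apply (continuous_comp_2 (fun tau => x0 + tau * (x - x0)) (fun _ => q) dphi tau).
        + apply (ex_derive_continuous (V := R_NormedModule)). auto_derive. exact I.
        + apply continuous_const.
        + apply Hc. }
    replace (x0 + 1 * (x - x0)) with x in Hi by ring.
    replace (x0 + 0 * (x - x0)) with x0 in Hi by ring.
    unfold minus, plus, opp in Hi; simpl in Hi.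
    unfold Rminus at 1. rewrite <- (is_RInt_unique _ _ _ _ Hi).
    rewrite (RInt_ext _ (fun tau => scal (x - x0) (dphi (x0 + tau * (x - x0)) q))).
    + rewrite (RInt_scal (V := R_CompleteNormedModule)).
      * unfold scal; simpl; unfold mult; simpl. apply Rmult_comm.
      * apply (ex_RInt_continuous (V := R_CompleteNormedModule)). intros tau _.
        apply (continuous_comp_2 (fun tau => x0 + tau * (x - x0)) (fun _ => q) dphi tau).
        -- apply (ex_derive_continuous (V := R_NormedModule)). auto_derive. exact I.
        -- apply continuous_const.
        -- apply Hc.
    + intros tau _. unfold scal; simpl; unfold mult; simpl. apply Rmult_comm.
Qed.

Lemma is_derive_continuous (f : R -> R) (s l : R) : is_derive f s l -> continuous f s.
Proof. intros H. apply (ex_derive_continuous (V := R_NormedModule)). now exists l. Qed.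

(** The arguments are moved one at a time. The first two increments factor by [hadamard], with
    factors jointly continuous in the moved argument and the later ones; the third moves with the
    others frozen at s and is the one-variable chain rule. The sum of the three slopes is the
    Caratheodory factor. *)
Lemma is_derive_comp3 (F Ft Fx Fy : R -> R -> R -> R) (u v w : R -> R) (s u' v' w' : R) :
  (forall t x y, is_derive (fun z => F z x y) t (Ft t x y)) ->
  (forall t x y, is_derive (fun z => F t z y) x (Fx t x y)) ->
  (forall t x y, is_derive (fun z => F t x z) y (Fy t x y)) ->
  cont3 Ft -> cont3 Fx ->
  is_derive u s u' -> is_derive v s v' -> is_derive w s w' ->
  is_derive (fun r => F (u r) (v r) (w r)) s
    (Ft (u s) (v s) (w s) * u' + Fx (u s) (v s) (w s) * v' + Fy (u s) (v s) (w s) * w').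
Proof.
  intros HFt HFx HFy Hct Hcx Hu Hv Hw.
  assert (Hcv := is_derive_continuous _ _ _ Hv).
  assert (Hcu := is_derive_continuous _ _ _ Hu).
  assert (Hcw := is_derive_continuous _ _ _ Hw).
  destruct (hadamard (U := prod_UniformSpace R_UniformSpace R_UniformSpace)
              (fun t q => F t (fst q) (snd q)) (fun t q => Ft t (fst q) (snd q)) (u s))
    as [mt [mtc [mt0 mte]]].
  { intros x q. apply HFt. }
  { intros x q.
    apply (cont3_comp Ft (fun z : R * (R * R) => fst z) (fun z => fst (snd z))
             (fun z => snd (snd z))); [exact Hct|apply continuous_fst| |];
      (apply (continuous_comp snd);
       [apply continuous_snd|first [apply continuous_fst|apply continuous_snd]]). }
  destruct (hadamard (fun x q => F (u s) x q) (fun x q => Fx (u s) x q) (v s))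
    as [mx [mxc [mx0 mxe]]].
  { intros x q. apply HFx. }
  { intros x q.
    apply (cont3_comp Fx (fun _ : R * R => u s) fst snd);
      [exact Hcx|apply continuous_const|apply continuous_fst|apply continuous_snd]. }
  destruct (proj1 (caratheodory _ _ _) Hu) as [su [suc [su0 sue]]].
  destruct (proj1 (caratheodory _ _ _) Hv) as [sv [svc [sv0 sve]]].
  assert (Hy : is_derive (fun r => F (u s) (v s) (w r)) s
                 (Fy (u s) (v s) (w s) * w')).
  { rewrite Rmult_comm. apply (is_derive_comp (fun z => F (u s) (v s) z) w s); auto. }
  destruct (proj1 (caratheodory _ _ _) Hy) as [sw [swc [sw0 swe]]].
  apply caratheodory.
  exists (fun r => mt (u r) (v r, w r) * su r + mx (v r) (w r) * sv r + sw r).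
  split; [|split].
  - apply (continuous_plus (V := R_NormedModule)); [|exact swc].
    apply (continuous_plus (V := R_NormedModule));
      apply (continuous_mult (K := R_AbsRing)); try assumption.
    + apply (continuous_comp_2 u (fun r => (v r, w r)) mt s Hcu).
      * now apply continuous_pair.
      * apply mtc.
    + apply (continuous_comp_2 v w mx s Hcv Hcw). apply mxc.
  - rewrite mt0, mx0, su0, sv0, sw0. reflexivity.
  - intros r.
    specialize (mte (u r) (v r, w r)). simpl in mte.
    specialize (mxe (v r) (w r)).
    specialize (sue r). specialize (sve r). specialize (swe r).
    rewrite sue in mte. rewrite sve in mxe.
    replace (F (u r) (v r) (w r) - F (u s) (v s) (w s)) with
      ((F (u r) (v r) (w r) - F (u s) (v r) (w r))
       + (F (u s) (v r) (w r) - F (u s) (v s) (w r))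
       + (F (u s) (v s) (w r) - F (u s) (v s) (w s))) by ring.
    rewrite mte, mxe, swe. ring.
Qed.

Lemma is_derive_comp2 (A Ax Ay : R -> R -> R) (u v : R -> R) (s u' v' : R) :
  (forall x y, is_derive (fun z => A z y) x (Ax x y)) ->
  (forall x y, is_derive (fun z => A x z) y (Ay x y)) ->
  cont3 (fun _ => Ax) -> is_derive u s u' -> is_derive v s v' ->
  is_derive (fun r => A (u r) (v r)) s (Ax (u s) (v s) * u' + Ay (u s) (v s) * v').
Proof.
  intros Hx Hy Hc Hu Hv.
  replace (Ax (u s) (v s) * u' + Ay (u s) (v s) * v')
    with (0 * 0 + Ax (u s) (v s) * u' + Ay (u s) (v s) * v') by ring.
  apply (is_derive_comp3 (fun _ => A) (fun _ _ _ => 0) (fun _ => Ax) (fun _ => Ay)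
           (fun _ => 0) u v); auto.
  - intros. apply (is_derive_const (V := R_NormedModule)).
  - intros t x y. apply continuous_const.
  - apply (is_derive_const (V := R_NormedModule)).
Qed.

(** Partial derivatives are witnesses of lower class instead of iterated [Derive]: this makes
    stability under sums, products and composition an induction on n, and lets later computations
    name the partials and finish by [ring]. *)
Fixpoint Cn (n : nat) (F : R -> R -> R -> R) : Prop :=
  cont3 F /\
  match n with
  | O => True
  | S m => exists Ft Fx Fy : R -> R -> R -> R,
      (forall t x y, is_derive (fun z => F z x y) t (Ft t x y)) /\
      (forall t x y, is_derive (fun z => F t z y) x (Fx t x y)) /\
      (forall t x y, is_derive (fun z => F t x z) y (Fy t x y)) /\
      Cn m Ft /\ Cn m Fx /\ Cn m Fy
  end.

Lemma Cn_cont3 n F : Cn n F -> cont3 F.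
Proof. destruct n; intros [H _]; exact H. Qed.

Ltac split_Cn := split; [|split; [|split; [|split; [|split]]]].

Lemma Cn_weaken n : forall F, Cn (S n) F -> Cn n F.
Proof.
  induction n as [|n IH]; intros F [Hc HF].
  - split; [exact Hc|exact I].
  - split; [exact Hc|].
    destruct HF as (Ft & Fx & Fy & H1 & H2 & H3 & H4 & H5 & H6).
    exists Ft, Fx, Fy. repeat (split; auto).
Qed.

Lemma smooth3_Cn (n : nat) (F : R -> R -> R -> R) : smooth3 F -> Cn n F.
Proof.
  intros HF.
  enough (H : forall n l, Cn n (pd3 l F)) by apply (H n nil).
  clear n. induction n as [|n IH]; intros l; destruct (HF l) as [Hd Hc].
  - split; [exact Hc|exact I].
  - split; [exact Hc|].
    exists (pd3 (Dt :: l) F), (pd3 (Defs.Dx :: l) F), (pd3 (Dy :: l) F).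
    split; [|split; [|split; [|split; [apply (IH (_ :: l))|split; apply (IH (_ :: l))]]]];
      intros t x y; apply Derive_correct; destruct (Hd t x y) as [? [? ?]]; assumption.
Qed.

Lemma Cn_const n : forall c, Cn n (fun _ _ _ => c).
Proof.
  induction n as [|n IH]; intros c; (split; [intros t x y; apply continuous_const|]).
  - exact I.
  - exists (fun _ _ _ => 0), (fun _ _ _ => 0), (fun _ _ _ => 0).
    split_Cn; [| | |apply IH..]; intros; apply (is_derive_const (V := R_NormedModule)).
Qed.

Lemma Cn_x n : Cn n (fun _ x _ => x).
Proof.
  destruct n; split.
  - intros t x y. apply (continuous_comp fst snd); [apply continuous_fst|apply continuous_snd].
  - exact I.
  - intros t x y. apply (continuous_comp fst snd); [apply continuous_fst|apply continuous_snd].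
  - exists (fun _ _ _ => 0), (fun _ _ _ => 1), (fun _ _ _ => 0).
    split_Cn; [| | |apply Cn_const..]; intros;
      first [apply (is_derive_const (V := R_NormedModule))|apply (is_derive_id (K := R_AbsRing))].
Qed.

Lemma Cn_y n : Cn n (fun _ _ y => y).
Proof.
  destruct n; split.
  - intros t x y. apply continuous_snd.
  - exact I.
  - intros t x y. apply continuous_snd.
  - exists (fun _ _ _ => 0), (fun _ _ _ => 0), (fun _ _ _ => 1).
    split_Cn; [| | |apply Cn_const..]; intros;
      first [apply (is_derive_const (V := R_NormedModule))|apply (is_derive_id (K := R_AbsRing))].
Qed.

Lemma Cn_plus n : forall F G, Cn n F -> Cn n G -> Cn n (fun t x y => F t x y + G t x y).
Proof.
  induction n as [|n IH]; intros F G [cF HF] [cG HG];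
    (split; [intros t x y; apply (continuous_plus (V := R_NormedModule)); auto|]).
  - exact I.
  - destruct HF as (Ft & Fx & Fy & H1 & H2 & H3 & H4 & H5 & H6).
    destruct HG as (Gt & Gx & Gy & K1 & K2 & K3 & K4 & K5 & K6).
    exists (fun t x y => Ft t x y + Gt t x y), (fun t x y => Fx t x y + Gx t x y),
      (fun t x y => Fy t x y + Gy t x y).
    split_Cn; [| | |auto..]; intros t x y; apply (is_derive_plus (V := R_NormedModule)); auto.
Qed.

Lemma is_derive_mult_R (f g : R -> R) (x f' g' : R) :
  is_derive f x f' -> is_derive g x g' ->
  is_derive (fun z => f z * g z) x (f' * g x + f x * g').
Proof.
  intros Hf Hg. apply (is_derive_mult (K := R_AbsRing) f g x f' g' Hf Hg).
  intros; apply Rmult_comm.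
Qed.

Lemma Cn_mult n : forall F G, Cn n F -> Cn n G -> Cn n (fun t x y => F t x y * G t x y).
Proof.
  induction n as [|n IH]; intros F G HF HG.
  - split; [|exact I]. destruct HF as [cF _], HG as [cG _].
    intros t x y; apply (continuous_mult (K := R_AbsRing)); auto.
  - assert (wF := Cn_weaken _ _ HF). assert (wG := Cn_weaken _ _ HG).
    destruct HF as [cF HF], HG as [cG HG].
    split; [intros t x y; apply (continuous_mult (K := R_AbsRing)); auto|].
    destruct HF as (Ft & Fx & Fy & H1 & H2 & H3 & H4 & H5 & H6).
    destruct HG as (Gt & Gx & Gy & K1 & K2 & K3 & K4 & K5 & K6).
    exists (fun t x y => Ft t x y * G t x y + F t x y * Gt t x y),
      (fun t x y => Fx t x y * G t x y + F t x y * Gx t x y),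
      (fun t x y => Fy t x y * G t x y + F t x y * Gy t x y).
    split_Cn; [| | |apply Cn_plus; apply IH; assumption..];
      intros t x y;
      [apply (is_derive_mult_R (fun z => F z x y) (fun z => G z x y))
      |apply (is_derive_mult_R (fun z => F t z y) (fun z => G t z y))
      |apply (is_derive_mult_R (fun z => F t x z) (fun z => G t x z))]; auto.
Qed.

(** The partials of the composite still contain [u], [v], [w] undifferentiated, so the induction
    hypothesis is applied to their weakened versions. *)
Lemma Cn_comp n : forall F u v w, Cn n F -> Cn n u -> Cn n v -> Cn n w ->
  Cn n (fun t x y => F (u t x y) (v t x y) (w t x y)).
Proof.
  induction n as [|n IH]; intros F u v w HF Hu Hv Hw.
  - split; [|exact I]. destruct HF as [cF _], Hu, Hv, Hw.
    intros t x y.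
    apply (cont3_comp F (fun p : R * R * R => u (fst (fst p)) (snd (fst p)) (snd p))
             (fun p => v (fst (fst p)) (snd (fst p)) (snd p))
             (fun p => w (fst (fst p)) (snd (fst p)) (snd p))); auto.
  - assert (wu := Cn_weaken _ _ Hu). assert (wv := Cn_weaken _ _ Hv).
    assert (ww := Cn_weaken _ _ Hw).
    destruct HF as [cF HF], Hu as [cu Hu], Hv as [cv Hv], Hw as [cw Hw].
    split.
    { intros t x y.
      apply (cont3_comp F (fun p : R * R * R => u (fst (fst p)) (snd (fst p)) (snd p))
               (fun p => v (fst (fst p)) (snd (fst p)) (snd p))
               (fun p => w (fst (fst p)) (snd (fst p)) (snd p))); auto. }
    destruct HF as (Ft & Fx & Fy & H1 & H2 & H3 & H4 & H5 & H6).
    destruct Hu as (ut & ux & uy & u1 & u2 & u3 & u4 & u5 & u6).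
    destruct Hv as (vt & vx & vy & v1 & v2 & v3 & v4 & v5 & v6).
    destruct Hw as (wt & wx & wy & w1 & w2 & w3 & w4 & w5 & w6).
    assert (ct := Cn_cont3 _ _ H4). assert (cx := Cn_cont3 _ _ H5).
    exists (fun t x y => Ft (u t x y) (v t x y) (w t x y) * ut t x y
                     + Fx (u t x y) (v t x y) (w t x y) * vt t x y
                     + Fy (u t x y) (v t x y) (w t x y) * wt t x y),
      (fun t x y => Ft (u t x y) (v t x y) (w t x y) * ux t x y
                     + Fx (u t x y) (v t x y) (w t x y) * vx t x y
                     + Fy (u t x y) (v t x y) (w t x y) * wx t x y),
      (fun t x y => Ft (u t x y) (v t x y) (w t x y) * uy t x y
                     + Fx (u t x y) (v t x y) (w t x y) * vy t x y
                     + Fy (u t x y) (v t x y) (w t x y) * wy t x y).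
    split; [|split; [|split]].
    + intros t x y.
      apply (is_derive_comp3 F Ft Fx Fy (fun z => u z x y) (fun z => v z x y) (fun z => w z x y));
        auto.
    + intros t x y.
      apply (is_derive_comp3 F Ft Fx Fy (fun z => u t z y) (fun z => v t z y) (fun z => w t z y));
        auto.
    + intros t x y.
      apply (is_derive_comp3 F Ft Fx Fy (fun z => u t x z) (fun z => v t x z) (fun z => w t x z));
        auto.
    + split; [|split]; repeat apply Cn_plus; apply Cn_mult; auto.
Qed.

(** * Symmetry of mixed partial derivatives *)

Lemma schwarz_mixed (f f1 f2 f12 f21 : R -> R -> R) (x y : R) :
  (forall u v, is_derive (fun z => f z v) u (f1 u v)) ->
  (forall u v, is_derive (fun z => f u z) v (f2 u v)) ->
  (forall u v, is_derive (fun z => f1 u z) v (f12 u v)) ->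
  (forall u v, is_derive (fun z => f2 z v) u (f21 u v)) ->
  (forall u v, continuous (fun p : R * R => f12 (fst p) (snd p)) (u, v)) ->
  (forall u v, continuous (fun p : R * R => f21 (fst p) (snd p)) (u, v)) ->
  f12 x y = f21 x y.
Proof.
  intros H1 H2 H12 H21 C12 C21.
  assert (E21 : forall u v, Derive (fun z => Derive (fun t => f z t) v) u = f21 u v).
  { intros u v. rewrite (Derive_ext _ (fun z => f2 z v)).
    - apply is_derive_unique, H21.
    - intros z. apply is_derive_unique, H2. }
  assert (E12 : forall u v, Derive (fun z => Derive (fun t => f t z) u) v = f12 u v).
  { intros u v. rewrite (Derive_ext _ (fun z => f1 u z)).
    - apply is_derive_unique, H12.
    - intros z. apply is_derive_unique, H1. }
  rewrite <- E12, <- E21. symmetry. apply Schwarz.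
  - exists (mkposreal 1 Rlt_0_1). intros u v _ _. repeat split.
    + eexists; apply H1.
    + eexists; apply H2.
    + apply (ex_derive_ext (fun z => f2 z v)).
      * intros z. symmetry. apply is_derive_unique, H2.
      * eexists; apply H21.
    + apply (ex_derive_ext (fun z => f1 u z)).
      * intros z. symmetry. apply is_derive_unique, H1.
      * eexists; apply H12.
  - apply (continuity_2d_pt_ext f21); [intros; symmetry; apply E21|].
    apply continuity_2d_pt_filterlim, C21.
  - apply (continuity_2d_pt_ext f12); [intros; symmetry; apply E12|].
    apply continuity_2d_pt_filterlim, C12.
Qed.

(** Each mixed partial is a single function serving both orders of differentiation, so that mixed
    terms cancel syntactically in the exterior derivatives below. *)
Lemma C2_mixed (F : R -> R -> R -> R) : Cn 2 F ->
  exists Ft Fx Fy Ftx Fty Fxy : R -> R -> R -> R,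
    (forall t x y, is_derive (fun z => F z x y) t (Ft t x y)) /\
    (forall t x y, is_derive (fun z => F t z y) x (Fx t x y)) /\
    (forall t x y, is_derive (fun z => F t x z) y (Fy t x y)) /\
    Cn 1 Ft /\ Cn 1 Fx /\ Cn 1 Fy /\
    (forall t x y, is_derive (fun z => Ft t z y) x (Ftx t x y)) /\
    (forall t x y, is_derive (fun z => Fx z x y) t (Ftx t x y)) /\
    (forall t x y, is_derive (fun z => Ft t x z) y (Fty t x y)) /\
    (forall t x y, is_derive (fun z => Fy z x y) t (Fty t x y)) /\
    (forall t x y, is_derive (fun z => Fx t x z) y (Fxy t x y)) /\
    (forall t x y, is_derive (fun z => Fy t z y) x (Fxy t x y)) /\
    cont3 Ftx /\ cont3 Fty /\ cont3 Fxy.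
Proof.
  intros [_ (Ft & Fx & Fy & H1 & H2 & H3 & H4 & H5 & H6)].
  exists Ft, Fx, Fy.
  destruct (H4) as [_ (Ftt & Ftx & Fty & t1 & t2 & t3 & [t4 _] & [t5 _] & [t6 _])].
  destruct (H5) as [_ (Fxt & Fxx & Fxy & x1 & x2 & x3 & [x4 _] & [x5 _] & [x6 _])].
  destruct (H6) as [_ (Fyt & Fyx & Fyy & y1 & y2 & y3 & [y4 _] & [y5 _] & [y6 _])].
  assert (Etx : forall t x y, Fxt t x y = Ftx t x y).
  { intros t x y. symmetry.
    apply (schwarz_mixed (fun t x => F t x y) (fun t x => Ft t x y) (fun t x => Fx t x y)
             (fun t x => Ftx t x y) (fun t x => Fxt t x y)); auto; intros u v;
      apply (cont3_comp _ (fun p : R * R => fst p) (fun p => snd p) (fun _ => y)); auto;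
      first [apply continuous_fst|apply continuous_snd|apply continuous_const]. }
  assert (Ety : forall t x y, Fyt t x y = Fty t x y).
  { intros t x y. symmetry.
    apply (schwarz_mixed (fun t y => F t x y) (fun t y => Ft t x y) (fun t y => Fy t x y)
             (fun t y => Fty t x y) (fun t y => Fyt t x y)); auto; intros u v;
      apply (cont3_comp _ (fun p : R * R => fst p) (fun _ => x) (fun p => snd p)); auto;
      first [apply continuous_fst|apply continuous_snd|apply continuous_const]. }
  assert (Exy : forall t x y, Fyx t x y = Fxy t x y).
  { intros t x y. symmetry.
    apply (schwarz_mixed (fun x y => F t x y) (fun x y => Fx t x y) (fun x y => Fy t x y)
             (fun x y => Fxy t x y) (fun x y => Fyx t x y)); auto; intros u v;
      apply (cont3_comp _ (fun _ => t) (fun p : R * R => fst p) (fun p => snd p)); auto;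
      first [apply continuous_fst|apply continuous_snd|apply continuous_const]. }
  exists Ftx, Fty, Fxy.
  repeat match goal with |- _ /\ _ => split; [first [assumption|idtac]|] end; auto;
    intros t x y; rewrite <- ?Etx, <- ?Ety, <- ?Exy; auto.
Qed.

(** * Green's formula on the disk *)

Lemma is_derive_RInt_fiber (k k' : R -> R -> R) (a b t : R) :
  (forall s th, is_derive (fun z => k z th) s (k' s th)) ->
  (forall s th, continuous (fun z : R * R => k' (fst z) (snd z)) (s, th)) ->
  (forall s th, continuous (k s) th) ->
  is_derive (fun s => RInt (k s) a b) t (RInt (k' t) a b).
Proof.
  intros Hd Hc Hk.
  rewrite (RInt_ext (k' t) (fun th => Derive (fun z => k z th) t)).
  2:{ intros th _. symmetry. apply is_derive_unique, Hd. }
  apply (is_derive_RInt_param k).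
  - apply filter_forall. intros s th _. eexists; apply Hd.
  - intros th _. apply (continuity_2d_pt_ext k').
    + intros u v. symmetry. apply is_derive_unique, Hd.
    + apply continuity_2d_pt_filterlim, Hc.
  - apply filter_forall. intros s.
    apply (ex_RInt_continuous (V := R_CompleteNormedModule)). intros; apply Hk.
Qed.

Lemma cont3_slice_y (F : R -> R -> R -> R) (t x y : R) :
  cont3 F -> continuous (F t x) y.
Proof.
  intros HF. apply (cont3_comp F (fun _ => t) (fun _ => x) (fun z => z));
    [exact HF|apply continuous_const..|apply continuous_id].
Qed.

(** With A the vertical primitive of k, the form - A dx has exterior derivative k dx /\ dy. Two
    nested integrals with limits depending on x thus become one integral over a fixed interval,
    where the one-dimensional parametric lemmas apply. *)
Definition vprim (k : R -> R -> R -> R) : R -> R -> R -> R :=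
  fun t x y => RInt (k t x) 0 y.

Lemma vprim_dy (k : R -> R -> R -> R) (t x y : R) :
  cont3 k -> is_derive (fun z => vprim k t x z) y (k t x y).
Proof.
  intros Hk. apply (is_derive_RInt (k t x) (fun z => vprim k t x z) 0 y).
  - apply filter_forall. intros z. apply (RInt_correct (V := R_CompleteNormedModule)).
    apply (ex_RInt_continuous (V := R_CompleteNormedModule)).
    intros; now apply cont3_slice_y.
  - now apply cont3_slice_y.
Qed.

Lemma vprim_cont3 (k : R -> R -> R -> R) : cont3 k -> cont3 (vprim k).
Proof.
  intros Hk t x y.
  (* Scaling the integration variable by y moves the variable endpoint into the integrand, which
     leaves a parametric integral over [0, 1]. *)
  apply (continuous_ext
    (fun p : R * R * R => snd p * RInt (fun u => k (fst (fst p)) (snd (fst p)) (snd p * u)) 0 1)).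
  - intros [[t' x'] y']. unfold vprim; simpl.
    assert (E := RInt_comp_lin (V := R_CompleteNormedModule) (k t' x') y' 0 0 1).
    rewrite (RInt_ext _ (fun u => scal y' (k t' x' (y' * u)))) in E.
    2:{ intros u _. f_equal. f_equal. ring. }
    rewrite (RInt_scal (V := R_CompleteNormedModule)) in E.
    + rewrite Rmult_0_r, Rmult_1_r, !Rplus_0_r in E. apply E.
      apply (ex_RInt_continuous (V := R_CompleteNormedModule)).
      intros; now apply cont3_slice_y.
    + apply (ex_RInt_continuous (V := R_CompleteNormedModule)). intros u _.
      apply (cont3_comp k (fun _ => t') (fun _ => x') (fun u => y' * u) u Hk);
        [apply continuous_const..|].
      apply (continuous_scal_r (V := R_NormedModule) y' (fun u => u)), continuous_id.
  - apply (continuous_mult (K := R_AbsRing)); [apply continuous_snd|].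
    apply (continuous_RInt_fiber (fun u (p : R * R * R) =>
             k (fst (fst p)) (snd (fst p)) (snd p * u))); [lra|].
    intros u q.
    apply (cont3_comp k (fun z : R * (R * R * R) => fst (fst (snd z)))
             (fun z => snd (fst (snd z))) (fun z => snd (snd z) * fst z) _ Hk).
    + apply (continuous_comp snd (fun z : R * R * R => fst (fst z))); [apply continuous_snd|].
      apply (continuous_comp fst fst); apply continuous_fst.
    + apply (continuous_comp snd (fun z : R * R * R => snd (fst z))); [apply continuous_snd|].
      apply (continuous_comp fst snd); [apply continuous_fst|apply continuous_snd].
    + apply (continuous_mult (K := R_AbsRing)); [|apply continuous_fst].
      apply (continuous_comp snd snd); apply continuous_snd.
Qed.

Lemma vprim_dt (k k' : R -> R -> R -> R) (t x y : R) :
  (forall t x y, is_derive (fun z => k z x y) t (k' t x y)) ->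
  cont3 k -> cont3 k' ->
  is_derive (fun z => vprim k z x y) t (vprim k' t x y).
Proof.
  intros Hd Hk Hk'.
  apply (is_derive_RInt_fiber (fun t y => k t x y) (fun t y => k' t x y)); auto.
  - intros s th. apply (cont3_comp k' fst (fun _ : R * R => x) snd _ Hk');
      [apply continuous_fst|apply continuous_const|apply continuous_snd].
  - intros s th. now apply cont3_slice_y.
Qed.

Lemma vprim_dx (k k' : R -> R -> R -> R) (t x y : R) :
  (forall t x y, is_derive (fun z => k t z y) x (k' t x y)) ->
  cont3 k -> cont3 k' ->
  is_derive (fun z => vprim k t z y) x (vprim k' t x y).
Proof.
  intros Hd Hk Hk'.
  apply (is_derive_RInt_fiber (fun x y => k t x y) (fun x y => k' t x y)); auto.
  - intros s th. apply (cont3_comp k' (fun _ : R * R => t) fst snd _ Hk');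
      [apply continuous_const|apply continuous_fst|apply continuous_snd].
  - intros s th. now apply cont3_slice_y.
Qed.

(** Agreement on the open disk is the useful form: at interior points, maps that agree on D also
    have equal derivatives. *)
Lemma int_D_ext (f g : R * R -> R) :
  (forall x y, x ^ 2 + y ^ 2 < 1 -> f (x, y) = g (x, y)) -> int_D f = int_D g.
Proof.
  intros Hfg. unfold int_D. apply RInt_ext. intros x Hx.
  rewrite Rmin_left, Rmax_right in Hx by lra.
  apply RInt_ext. intros y Hy. apply Hfg.
  assert (Hs : 0 <= sqrt (1 - x ^ 2)) by apply sqrt_pos.
  rewrite Rmin_left, Rmax_right in Hy by lra.
  assert (Hq : sqrt (1 - x ^ 2) * sqrt (1 - x ^ 2) = 1 - x ^ 2) by (apply sqrt_sqrt; nra).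
  nra.
Qed.

Lemma cont3_circle (A : R -> R -> R -> R) (t th : R) :
  cont3 A -> continuous (fun th => A t (cos th) (sin th)) th.
Proof.
  intros HA. apply (cont3_comp A (fun _ => t) cos sin _ HA);
    [apply continuous_const|apply continuous_cos|apply continuous_sin].
Qed.

Lemma ex_RInt_cont (f : R -> R) (a b : R) : (forall x, continuous f x) -> ex_RInt f a b.
Proof. intros Hf. apply (ex_RInt_continuous (V := R_CompleteNormedModule)). auto. Qed.

(* Green's formula for the form [- A dx]; the two semicircles are graphs over the x-axis. *)
Lemma int_D_dy (A f : R -> R -> R) :
  (forall x y, is_derive (A x) y (f x y)) ->
  cont3 (fun _ => A) -> cont3 (fun _ => f) ->
  int_D (fun p => f (fst p) (snd p)) = RInt (fun th => A (cos th) (sin th) * sin th) 0 (2 * PI).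
Proof.
  intros Hd HA Hf. assert (Hpi := PI_RGT_0).
  set (s := fun x => sqrt (1 - x ^ 2)).
  (* [sqrt] is 0 at negative arguments, so [s] is continuous on the whole line and not just on
     [-1, 1]. *)
  assert (Hs : forall x, continuous s x).
  { intros x. apply (continuous_comp (fun x => 1 - x ^ 2) sqrt).
    - apply (ex_derive_continuous (V := R_NormedModule)). auto_derive. exact I.
    - apply continuous_sqrt. }
  assert (Cu : forall x, continuous (fun x => A x (s x)) x).
  { intros x. apply (cont3_comp (fun _ => A) (fun _ => 0) (fun x => x) s x HA);
      [apply continuous_const|apply continuous_id|apply Hs]. }
  assert (Cl : forall x, continuous (fun x => A x (- s x)) x).
  { intros x. apply (cont3_comp (fun _ => A) (fun _ => 0) (fun x => x) (fun x => - s x) x HA);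
      [apply continuous_const|apply continuous_id|].
    apply (continuous_opp (V := R_NormedModule)), Hs. }
  assert (E1 : int_D (fun p => f (fst p) (snd p))
               = RInt (fun x => A x (s x)) (-1) 1 - RInt (fun x => A x (- s x)) (-1) 1).
  { transitivity (RInt (fun x => minus (A x (s x)) (A x (- s x))) (-1) 1).
    - unfold int_D. apply RInt_ext. intros x _.
      apply is_RInt_unique. apply (is_RInt_derive (A x) (f x)).
      + intros y _. apply Hd.
      + intros y _. apply (cont3_slice_y (fun _ => f) 0 x y Hf).
    - apply (RInt_minus (V := R_CompleteNormedModule)); now apply ex_RInt_cont. }
  assert (Cs : forall th, continuous (fun th => A (cos th) (sin th) * sin th) th).
  { intros th. apply (continuous_mult (K := R_AbsRing)); [|apply continuous_sin].
    apply (cont3_circle (fun _ => A) 0 th HA). }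
  assert (Hcos : forall th, is_derive cos th (- sin th) /\ continuous (fun th => - sin th) th).
  { intros th. split; [apply is_derive_cos|].
    apply (continuous_opp (V := R_NormedModule)), continuous_sin. }
  (* On [0, PI] the cosine decreases from 1 to -1: the swapped limits absorb the sign of its
     derivative. On [PI, 2 PI] it increases, and the sign survives as the minus of the lower arc. *)
  assert (E2 : RInt (fun th => A (cos th) (sin th) * sin th) 0 PI
               = RInt (fun x => A x (s x)) (-1) 1).
  { assert (E := RInt_comp (V := R_CompleteNormedModule) (fun x => A x (s x)) cos
                  (fun th => - sin th) 0 PI (fun th _ => Cu (cos th)) (fun th _ => Hcos th)).
    rewrite cos_0, cos_PI in E.
    transitivity (opp (RInt (fun x => A x (s x)) 1 (-1))).
    2:{ apply (opp_RInt_swap (V := R_CompleteNormedModule)). now apply ex_RInt_cont. }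
    simpl in E. rewrite <- E.
    symmetry. etransitivity.
    1:{ symmetry. apply (RInt_opp (V := R_CompleteNormedModule)).
      apply ex_RInt_cont. intros th. apply (continuous_mult (K := R_AbsRing)); [apply Hcos|].
      apply (continuous_comp cos (fun x => A x (s x))); [apply continuous_cos|apply Cu]. }
    apply RInt_ext. intros th Hth. rewrite Rmin_left, Rmax_right in Hth by lra.
      unfold opp, scal; simpl; unfold mult; simpl.
      replace (s (cos th)) with (sin th); [ring|].
    unfold s. assert (Hsin : 0 <= sin th) by (apply sin_ge_0; lra).
    rewrite <- (sqrt_pow2 (sin th) Hsin) at 1. f_equal.
    assert (H := sin2_cos2 th). unfold Rsqr in H. simpl. lra. }
  assert (E3 : RInt (fun th => A (cos th) (sin th) * sin th) PI (2 * PI)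
               = - RInt (fun x => A x (- s x)) (-1) 1).
  { assert (E := RInt_comp (V := R_CompleteNormedModule) (fun x => A x (- s x)) cos
                  (fun th => - sin th) PI (2 * PI)
                  (fun th _ => Cl (cos th)) (fun th _ => Hcos th)).
    rewrite cos_2PI, cos_PI in E. simpl in E. rewrite <- E.
    symmetry. etransitivity.
    - symmetry. apply (RInt_opp (V := R_CompleteNormedModule)).
      apply ex_RInt_cont. intros th. apply (continuous_mult (K := R_AbsRing)); [apply Hcos|].
      apply (continuous_comp cos (fun x => A x (- s x))); [apply continuous_cos|apply Cl].
    - apply RInt_ext. intros th Hth. rewrite Rmin_left, Rmax_right in Hth by lra.
      unfold opp, scal; simpl; unfold mult; simpl.
      replace (s (cos th)) with (- sin th); [rewrite Ropp_involutive; ring|].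
      unfold s. assert (Hsin : sin th <= 0) by (apply sin_le_0; lra).
      rewrite <- (sqrt_pow2 (- sin th)) at 1 by lra. f_equal.
      assert (H := sin2_cos2 th). unfold Rsqr in H. simpl. lra. }
  rewrite E1, <- E2.
  rewrite <- (RInt_Chasles (V := R_CompleteNormedModule) _ 0 PI (2 * PI))
    by now apply ex_RInt_cont.
  rewrite E3. reflexivity.
Qed.

Lemma is_derive_on_circle (B Bx By : R -> R -> R) (th : R) :
  (forall x y, is_derive (fun z => B z y) x (Bx x y)) ->
  (forall x y, is_derive (fun z => B x z) y (By x y)) ->
  cont3 (fun _ => Bx) ->
  is_derive (fun th => B (cos th) (sin th)) th
    (Bx (cos th) (sin th) * - sin th + By (cos th) (sin th) * cos th).
Proof.
  intros Hx Hy Hc.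
  now apply (is_derive_comp2 B Bx By cos sin); [| | |apply is_derive_cos|apply is_derive_sin].
Qed.

Lemma RInt_derive_R (f f' : R -> R) (a b : R) :
  (forall x, is_derive f x (f' x)) -> (forall x, continuous f' x) ->
  RInt f' a b = f b - f a.
Proof.
  intros Hd Hc. apply is_RInt_unique. apply (is_RInt_derive f f'); auto.
Qed.

(* With [B] the vertical primitive of [U], the exact form [dB = B_x dx + U dy] integrates
   to zero on the circle, which reduces the claim to the previous Green formula. *)
Lemma int_D_dx (U f : R -> R -> R) :
  (forall x y, is_derive (fun z => U z y) x (f x y)) ->
  cont3 (fun _ => U) -> cont3 (fun _ => f) ->
  int_D (fun p => f (fst p) (snd p)) = RInt (fun th => U (cos th) (sin th) * cos th) 0 (2 * PI).
Proof.
  intros Hd HU Hf.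
  set (A := vprim (fun _ => f) 0). set (B := vprim (fun _ => U) 0).
  assert (cA : cont3 (fun _ => A)) by now apply cont3_freeze, vprim_cont3.
  assert (dA : forall x y, is_derive (A x) y (f x y)) by (intros; now apply vprim_dy).
  assert (dBy : forall x y, is_derive (fun z => B x z) y (U x y)) by (intros; now apply vprim_dy).
  assert (dBx : forall x y, is_derive (fun z => B z y) x (A x y)).
  { intros x y. apply (vprim_dx (fun _ => U) (fun _ => f)); auto. }
  rewrite (int_D_dy A f dA cA Hf).
  assert (cUc : forall th, continuous (fun th => U (cos th) (sin th) * cos th) th).
  { intros th. apply (continuous_mult (K := R_AbsRing)); [|apply continuous_cos].
    apply (cont3_circle (fun _ => U) 0 th HU). }
  assert (cAs : forall th, continuous (fun th => A (cos th) (sin th) * sin th) th).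
  { intros th. apply (continuous_mult (K := R_AbsRing)); [|apply continuous_sin].
    apply (cont3_circle (fun _ => A) 0 th cA). }
  assert (E0 : RInt (fun th => minus (U (cos th) (sin th) * cos th) (A (cos th) (sin th) * sin th))
                 0 (2 * PI) = 0).
  { transitivity (B (cos (2 * PI)) (sin (2 * PI)) - B (cos 0) (sin 0)).
    - apply (RInt_derive_R (fun th => B (cos th) (sin th))).
      + intros th. unfold minus, plus, opp; simpl.
        replace (U (cos th) (sin th) * cos th + - (A (cos th) (sin th) * sin th))
          with (A (cos th) (sin th) * - sin th + U (cos th) (sin th) * cos th) by ring.
        now apply is_derive_on_circle.
      + intros th. now apply (continuous_minus (V := R_NormedModule)).
    - rewrite cos_2PI, sin_2PI, cos_0, sin_0. apply Rminus_diag. }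
  rewrite (RInt_minus (V := R_CompleteNormedModule)) in E0 by now apply ex_RInt_cont.
  unfold minus, plus, opp in E0; simpl in E0. lra.
Qed.

Lemma int_D_vprim (k : R -> R -> R -> R) (t : R) : cont3 k ->
  int_D (fun p => k t (fst p) (snd p))
  = RInt (fun th => vprim k t (cos th) (sin th) * sin th) 0 (2 * PI).
Proof.
  intros Hk.
  apply (int_D_dy (vprim k t) (k t)).
  - intros x y. now apply vprim_dy.
  - now apply cont3_freeze, vprim_cont3.
  - now apply cont3_freeze.
Qed.

Lemma is_derive_int_D (k k' : R -> R -> R -> R) (t : R) :
  (forall t x y, is_derive (fun z => k z x y) t (k' t x y)) ->
  cont3 k -> cont3 k' ->
  is_derive (fun t => int_D (fun p => k t (fst p) (snd p))) t
    (int_D (fun p => k' t (fst p) (snd p))).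
Proof.
  intros Hd Hk Hk'.
  apply (is_derive_ext (fun t => RInt (fun th => vprim k t (cos th) (sin th) * sin th) 0 (2 * PI))).
  { intros s. symmetry. now apply int_D_vprim. }
  rewrite int_D_vprim by assumption.
  apply (is_derive_RInt_fiber (fun t th => vprim k t (cos th) (sin th) * sin th)
           (fun t th => vprim k' t (cos th) (sin th) * sin th)).
  - intros s th.
    replace (vprim k' s (cos th) (sin th) * sin th)
      with (vprim k' s (cos th) (sin th) * sin th + vprim k s (cos th) (sin th) * 0) by ring.
    apply (is_derive_mult_R (fun s => vprim k s (cos th) (sin th)) (fun _ => sin th));
      [now apply vprim_dt|].
    apply (is_derive_const (V := R_NormedModule)).
  - intros s th. apply (continuous_mult (K := R_AbsRing)).
    + apply (cont3_comp (vprim k') fst (fun z : R * R => cos (snd z)) (fun z => sin (snd z)) (s, th)).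
      * now apply vprim_cont3.
      * apply continuous_fst.
      * apply (continuous_comp snd cos); [apply continuous_snd|apply continuous_cos].
      * apply (continuous_comp snd sin); [apply continuous_snd|apply continuous_sin].
    + apply (continuous_comp snd sin); [apply continuous_snd|apply continuous_sin].
  - intros s th. apply (continuous_mult (K := R_AbsRing)); [|apply continuous_sin].
    now apply cont3_circle, vprim_cont3.
Qed.

Lemma continuous_int_D (k : R -> R -> R -> R) (t : R) :
  cont3 k -> continuous (fun t => int_D (fun p => k t (fst p) (snd p))) t.
Proof.
  intros Hk. assert (Hpi := PI_RGT_0).
  apply (continuous_ext (fun t => RInt (fun th => vprim k t (cos th) (sin th) * sin th) 0 (2 * PI))).
  { intros s. symmetry. now apply int_D_vprim. }
  apply (continuous_RInt_fiber (fun th t => vprim k t (cos th) (sin th) * sin th)); [lra|].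
  intros th s. apply (continuous_mult (K := R_AbsRing)).
  - apply (cont3_comp (vprim k) snd (fun z : R * R => cos (fst z)) (fun z => sin (fst z)) (th, s)).
    + now apply vprim_cont3.
    + apply continuous_snd.
    + apply (continuous_comp fst cos); [apply continuous_fst|apply continuous_cos].
    + apply (continuous_comp fst sin); [apply continuous_fst|apply continuous_sin].
  - apply (continuous_comp fst sin); [apply continuous_fst|apply continuous_sin].
Qed.

(** Linearity is checked on the circle integrals of the vertical primitives, whose integrands are
    continuous, so integrability is immediate. *)
Lemma int_D_lin (f g : R -> R -> R) (al be : R) :
  cont3 (fun _ => f) -> cont3 (fun _ => g) ->
  int_D (fun p => al * f (fst p) (snd p) + be * g (fst p) (snd p))
  = al * int_D (fun p => f (fst p) (snd p)) + be * int_D (fun p => g (fst p) (snd p)).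
Proof.
  intros Hf Hg.
  assert (cf := vprim_cont3 _ Hf). assert (cg := vprim_cont3 _ Hg).
  rewrite (int_D_vprim (fun _ => f) 0 Hf), (int_D_vprim (fun _ => g) 0 Hg).
  assert (L : forall F G : R -> R -> R -> R, cont3 F -> cont3 G ->
            cont3 (fun t x y => al * F t x y + be * G t x y)).
  { intros F G HF HG t x y. apply (continuous_plus (V := R_NormedModule));
      apply (continuous_mult (K := R_AbsRing)); auto; apply continuous_const. }
  rewrite (int_D_dy (fun x y => al * vprim (fun _ => f) 0 x y + be * vprim (fun _ => g) 0 x y)
             (fun x y => al * f x y + be * g x y)).
  - assert (cI : forall k, cont3 k ->
      ex_RInt (fun th => vprim k 0 (cos th) (sin th) * sin th) 0 (2 * PI)).
    { intros k Hk. apply ex_RInt_cont. intros th.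
      apply (continuous_mult (K := R_AbsRing)); [|apply continuous_sin].
      now apply cont3_circle, vprim_cont3. }
    assert (E := RInt_plus (V := R_CompleteNormedModule) _ _ 0 (2 * PI)
      (ex_RInt_scal (V := R_NormedModule) _ 0 (2 * PI) al (cI _ Hf))
      (ex_RInt_scal (V := R_NormedModule) _ 0 (2 * PI) be (cI _ Hg))).
    rewrite !(RInt_scal (V := R_CompleteNormedModule)) in E by now apply cI.
    rewrite (RInt_ext _ (fun th =>
      (al * vprim (fun _ => f) 0 (cos th) (sin th)
       + be * vprim (fun _ => g) 0 (cos th) (sin th)) * sin th)) in E; [exact E|].
    intros th _. unfold plus, scal; simpl; unfold mult; simpl. ring.
  - intros x y. apply (is_derive_plus (V := R_NormedModule));
      apply (is_derive_scal (fun z => vprim _ 0 x z) y); now apply (vprim_dy (fun _ => _)).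
  - intros t x y. apply (L _ _ cf cg t x y).
  - apply (L _ _ Hf Hg).
Qed.

Lemma green_disk (P Q Py Qx : R -> R -> R) :
  (forall x y, is_derive (fun z => Q z y) x (Qx x y)) ->
  (forall x y, is_derive (fun z => P x z) y (Py x y)) ->
  cont3 (fun _ => P) -> cont3 (fun _ => Q) -> cont3 (fun _ => Py) -> cont3 (fun _ => Qx) ->
  int_D (fun p => Qx (fst p) (snd p) - Py (fst p) (snd p))
  = RInt (fun th => P (cos th) (sin th) * - sin th + Q (cos th) (sin th) * cos th) 0 (2 * PI).
Proof.
  intros HQ HP cP cQ cPy cQx.
  transitivity (1 * int_D (fun p => Qx (fst p) (snd p)) + -1 * int_D (fun p => Py (fst p) (snd p))).
  { rewrite <- int_D_lin by assumption. apply int_D_ext. intros x y _. ring. }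
  rewrite (int_D_dx Q Qx), (int_D_dy P Py) by assumption.
  assert (I1 : ex_RInt (fun th => Q (cos th) (sin th) * cos th) 0 (2 * PI)).
  { apply ex_RInt_cont. intros th. apply (continuous_mult (K := R_AbsRing));
      [apply (cont3_circle (fun _ => Q) 0 th cQ)|apply continuous_cos]. }
  assert (I2 : ex_RInt (fun th => P (cos th) (sin th) * sin th) 0 (2 * PI)).
  { apply ex_RInt_cont. intros th. apply (continuous_mult (K := R_AbsRing));
      [apply (cont3_circle (fun _ => P) 0 th cP)|apply continuous_sin]. }
  assert (E := RInt_minus (V := R_CompleteNormedModule) _ _ 0 (2 * PI) I1 I2).
  rewrite (RInt_ext _ (fun th =>
    P (cos th) (sin th) * - sin th + Q (cos th) (sin th) * cos th)) in E.
  - rewrite E. unfold minus, plus, opp; simpl. ring.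
  - intros th _. unfold minus, plus, opp; simpl. ring.
Qed.

(** * Curves on the circle *)

(** The cosine of the difference is 1, so the sine of half the difference vanishes. *)
Lemma cos_sin_eq_mod (x y : R) :
  cos x = cos y -> sin x = sin y -> exists k : Z, x = y + 2 * PI * IZR k.
Proof.
  intros Hc Hs.
  assert (H1 : cos (2 * ((x - y) / 2)) = 1).
  { replace (2 * ((x - y) / 2)) with (x - y) by field.
    rewrite cos_minus, Hc, Hs. assert (H := sin2_cos2 y). unfold Rsqr in H. lra. }
  rewrite cos_2a_sin in H1.
  destruct (sin_eq_0_0 ((x - y) / 2)) as [k Hk]; [nra|].
  exists k. lra.
Qed.

(** The difference of two lifts is continuous with values in the discrete set 2 PI Z, hence
    constant. *)
Lemma lift_unique (phi psi : R -> R) (a b : R) :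
  a <= b ->
  (forall x, continuous phi x) -> (forall x, continuous psi x) ->
  (forall x, a <= x <= b -> cos (phi x) = cos (psi x) /\ sin (phi x) = sin (psi x)) ->
  phi b - psi b = phi a - psi a.
Proof.
  intros Hab Hphi Hpsi He. assert (Hpi := PI_RGT_0).
  assert (Hz : forall x, a <= x <= b -> exists k, phi x - psi x = 2 * PI * IZR k).
  { intros x Hx. destruct (He x Hx) as [Hc Hs].
    destruct (cos_sin_eq_mod _ _ Hc Hs) as [k Hk]. exists k. lra. }
  destruct (Hz a) as [ka Ha]; [lra|]. destruct (Hz b) as [kb Hb]; [lra|].
  rewrite Ha, Hb.
  destruct (Z.eq_dec ka kb) as [->|Hk]; [reflexivity|exfalso].
  (* An odd multiple of PI between the two end values: the intermediate value theorem attains it,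
     and parity excludes it. *)
  set (y := 2 * PI * IZR ka + (if Z_lt_dec ka kb then PI else - PI)).
  destruct (IVT_gen (fun x => phi x - psi x) a b y) as [x [Hx Hy]].
  - intros x. apply continuity_pt_filterlim.
    now apply (continuous_minus (V := R_NormedModule)).
  - rewrite Ha, Hb. unfold y. destruct (Z_lt_dec ka kb) as [l|l].
    + assert (IZR (ka + 1) <= IZR kb) by (apply IZR_le; lia). rewrite plus_IZR in H.
      rewrite Rmin_left, Rmax_right by nra. nra.
    + assert (IZR (kb + 1) <= IZR ka) by (apply IZR_le; lia). rewrite plus_IZR in H.
      rewrite Rmin_right, Rmax_left by nra. nra.
  - rewrite Rmin_left, Rmax_right in Hx by lra.
    destruct (Hz x Hx) as [k Hk']. rewrite Hk' in Hy. unfold y in Hy.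
    assert (E : 2 * IZR k = 2 * IZR ka + (if Z_lt_dec ka kb then 1 else -1)).
    { apply (Rmult_eq_reg_l PI); [|lra]. destruct (Z_lt_dec ka kb); lra. }
    destruct (Z_lt_dec ka kb).
    + assert (E' : IZR (2 * k) = IZR (2 * ka + 1)) by (rewrite plus_IZR, !mult_IZR; exact E).
      apply eq_IZR in E'. lia.
    + assert (E' : IZR (2 * k) = IZR (2 * ka + -1)) by (rewrite plus_IZR, !mult_IZR; exact E).
      apply eq_IZR in E'. lia.
Qed.

Section CircleCurve.

Variables (g1 g2 dg1 dg2 phi : R -> R) (a b : R).
Hypotheses (Hab : a <= b)
  (Hd1 : forall t, is_derive g1 t (dg1 t)) (Hd2 : forall t, is_derive g2 t (dg2 t))
  (Hc1 : forall t, continuous dg1 t) (Hc2 : forall t, continuous dg2 t)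
  (Hphi : forall t, continuous phi t)
  (Hon : forall t, a <= t <= b -> g1 t = cos (phi t) /\ g2 t = sin (phi t)).

(** The angular velocity of the curve, expressed without [phi], which is only known to be
    continuous. *)
Let w := fun t => g1 t * dg2 t - g2 t * dg1 t.

(** Differentiating |g|^2 = 1 makes the velocity orthogonal to g, hence a multiple of (- g2, g1).
    The norm is known to be 1 only on [a, b], which is why t is interior. *)
Lemma circle_curve_velocity (t : R) : a < t < b -> dg1 t = - g2 t * w t /\ dg2 t = g1 t * w t.
Proof.
  intros Ht.
  assert (N : forall s, a <= s <= b -> g1 s * g1 s + g2 s * g2 s = 1).
  { intros s Hs. destruct (Hon s Hs) as [-> ->].
    assert (H := sin2_cos2 (phi s)). unfold Rsqr in H. lra. }
  assert (D1 : is_derive (fun s => g1 s * g1 s + g2 s * g2 s) t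
                 (dg1 t * g1 t + g1 t * dg1 t + (dg2 t * g2 t + g2 t * dg2 t))).
  { apply (is_derive_plus (V := R_NormedModule)); now apply is_derive_mult_R. }
  assert (D0 : is_derive (fun s => g1 s * g1 s + g2 s * g2 s) t 0).
  { apply (is_derive_ext_loc (fun _ => 1)).
    - assert (He : 0 < Rmin (t - a) (b - t)) by (apply Rmin_pos; lra).
      exists (mkposreal _ He). intros s Hs. symmetry. apply N.
      assert (Hs' : Rabs (s - t) < Rmin (t - a) (b - t)) by exact Hs.
      assert (H1 := Rmin_l (t - a) (b - t)). assert (H2 := Rmin_r (t - a) (b - t)).
      apply Rabs_def2 in Hs'. lra.
    - apply (is_derive_const (V := R_NormedModule)). }
  apply is_derive_unique in D1. apply is_derive_unique in D0. rewrite D0 in D1.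
  assert (Nt := N t ltac:(lra)). unfold w.
  assert (O : g1 t * dg1 t = - (g2 t * dg2 t)) by lra.
  split.
  - replace (dg1 t) with (dg1 t * (g1 t * g1 t + g2 t * g2 t)) at 1 by (rewrite Nt; ring).
    replace (dg1 t * (g1 t * g1 t + g2 t * g2 t))
      with (g1 t * dg1 t * g1 t + dg1 t * g2 t * g2 t) by ring.
    rewrite O. ring.
  - replace (dg2 t) with (dg2 t * (g1 t * g1 t + g2 t * g2 t)) at 1 by (rewrite Nt; ring).
    replace (dg2 t * (g1 t * g1 t + g2 t * g2 t))
      with (- - (g2 t * dg2 t) * g2 t + dg2 t * g1 t * g1 t) by ring.
    rewrite <- O. ring.
Qed.

(* A solution of the angular equation [psi' = w] starting at [phi a] is again a lift,
   so it coincides with [phi], which is therefore differentiable. *)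
Lemma lift_C1 : exists psi : R -> R,
  (forall t, is_derive psi t (w t)) /\ forall t, a <= t <= b -> psi t = phi t.
Proof.
  assert (cg1 : forall t, continuous g1 t) by (intros t; apply (is_derive_continuous _ _ _ (Hd1 t))).
  assert (cg2 : forall t, continuous g2 t) by (intros t; apply (is_derive_continuous _ _ _ (Hd2 t))).
  assert (cw : forall t, continuous w t).
  { intros t. apply (continuous_minus (V := R_NormedModule));
      apply (continuous_mult (K := R_AbsRing)); auto. }
  set (psi := fun t => phi a + RInt w a t).
  assert (dpsi : forall t, is_derive psi t (w t)).
  { intros t. rewrite <- (Rplus_0_l (w t)).
    apply (is_derive_plus (V := R_NormedModule)); [apply (is_derive_const (V := R_NormedModule))|].
    apply (is_derive_RInt w (fun t => RInt w a t) a t); [|apply cw].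
    apply filter_forall. intros s. apply (RInt_correct (V := R_CompleteNormedModule)).
    now apply ex_RInt_cont. }
  assert (psia : psi a = phi a).
  { unfold psi. rewrite RInt_point. unfold zero; simpl. ring. }
  exists psi. split; [exact dpsi|].
  (* The inner product of g with the unit vector at angle [psi] starts at 1 and has zero derivative
     on the interior. Two unit vectors with inner product 1 coincide. *)
  assert (dE : forall t, is_derive (fun t => g1 t * cos (psi t) + g2 t * sin (psi t)) t
     (dg1 t * cos (psi t) + g1 t * (w t * - sin (psi t))
      + (dg2 t * sin (psi t) + g2 t * (w t * cos (psi t))))).
  { intros t. apply (is_derive_plus (V := R_NormedModule)).
    - apply (is_derive_mult_R g1 (fun t => cos (psi t))); [apply Hd1|].
      apply (is_derive_comp cos psi); [apply is_derive_cos|apply dpsi].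
    - apply (is_derive_mult_R g2 (fun t => sin (psi t))); [apply Hd2|].
      apply (is_derive_comp sin psi); [apply is_derive_sin|apply dpsi]. }
  assert (Hlift : forall t, a <= t <= b -> cos (psi t) = cos (phi t) /\ sin (psi t) = sin (phi t)).
  { intros t Ht.
    assert (E1 : g1 t * cos (psi t) + g2 t * sin (psi t) = 1).
    { destruct (MVT_gen (fun t => g1 t * cos (psi t) + g2 t * sin (psi t)) a t (fun _ => 0))
        as [c [_ Hc]].
      - intros x Hx. rewrite Rmin_left, Rmax_right in Hx by lra.
        destruct (circle_curve_velocity x ltac:(lra)) as [V1 V2].
        replace 0 with (dg1 x * cos (psi x) + g1 x * (w x * - sin (psi x))
                        + (dg2 x * sin (psi x) + g2 x * (w x * cos (psi x)))); [apply dE|].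
        rewrite V1, V2. ring.
      - intros x _. apply continuity_pt_filterlim. apply (is_derive_continuous _ _ _ (dE x)).
      - rewrite psia in Hc. destruct (Hon a ltac:(lra)) as [A1 A2]. rewrite A1, A2 in Hc.
        assert (H := sin2_cos2 (phi a)). unfold Rsqr in H. lra. }
    destruct (Hon t Ht) as [T1 T2]. rewrite T1, T2 in E1.
    assert (S1 := sin2_cos2 (phi t)). assert (S2 := sin2_cos2 (psi t)). unfold Rsqr in S1, S2.
    destruct (Rplus_sqr_eq_0 (cos (psi t) - cos (phi t)) (sin (psi t) - sin (phi t)));
      [unfold Rsqr; nra|lra]. }
  intros t Ht.
  assert (H := lift_unique psi phi a t ltac:(lra)).
  enough (psi t - phi t = psi a - phi a) by lra.
  apply H; [|exact Hphi|].
  - intros x. apply (is_derive_continuous _ _ _ (dpsi x)).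
  - intros x Hx. apply Hlift. lra.
Qed.

(** By the velocity formula the integrand is the circle form at angle [psi] times psi', so
    substitution leaves only the endpoints of the lift. *)
Lemma line_integral_lift (P Q : R -> R -> R) :
  cont3 (fun _ => P) -> cont3 (fun _ => Q) ->
  RInt (fun t => P (g1 t) (g2 t) * dg1 t + Q (g1 t) (g2 t) * dg2 t) a b
  = RInt (fun th => P (cos th) (sin th) * - sin th + Q (cos th) (sin th) * cos th) (phi a) (phi b).
Proof.
  intros HP HQ.
  destruct lift_C1 as [psi [dpsi Hpsi]].
  assert (cg1 : forall t, continuous g1 t) by (intros t; apply (is_derive_continuous _ _ _ (Hd1 t))).
  assert (cg2 : forall t, continuous g2 t) by (intros t; apply (is_derive_continuous _ _ _ (Hd2 t))).
  rewrite <- (Hpsi a), <- (Hpsi b) by lra.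
  rewrite <- (RInt_comp (V := R_CompleteNormedModule)
    (fun th => P (cos th) (sin th) * - sin th + Q (cos th) (sin th) * cos th) psi w a b).
  - apply RInt_ext. intros t Ht. rewrite Rmin_left, Rmax_right in Ht by lra.
    destruct (circle_curve_velocity t Ht) as [V1 V2]. rewrite V1, V2.
    rewrite (Hpsi t) by lra. destruct (Hon t ltac:(lra)) as [-> ->].
    unfold scal; simpl; unfold mult; simpl. ring.
  - intros t _. apply (continuous_plus (V := R_NormedModule));
      apply (continuous_mult (K := R_AbsRing)).
    + apply (cont3_circle (fun _ => P) 0 _ HP).
    + apply (continuous_opp (V := R_NormedModule)), continuous_sin.
    + apply (cont3_circle (fun _ => Q) 0 _ HQ).
    + apply continuous_cos.
  - intros t _. split; [apply dpsi|]. apply (continuous_minus (V := R_NormedModule));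
      apply (continuous_mult (K := R_AbsRing)); auto.
Qed.

End CircleCurve.

Lemma RInt_periodic (c : R -> R) (T x : R) :
  (forall x, continuous c x) -> (forall x, c (x + T) = c x) ->
  RInt c x (x + T) = RInt c 0 T.
Proof.
  intros Hc HT.
  assert (E : RInt c T (x + T) = RInt c 0 x).
  { assert (E := RInt_comp_lin (V := R_CompleteNormedModule) c 1 T 0 x).
    rewrite Rmult_0_r, Rplus_0_l, Rmult_1_l in E. rewrite <- E by now apply ex_RInt_cont.
    apply RInt_ext. intros t _. rewrite <- (HT t).
    unfold scal; simpl; unfold mult; simpl. rewrite !Rmult_1_l. reflexivity. }
  assert (E1 := RInt_Chasles (V := R_CompleteNormedModule) c 0 x (x + T)
                  (ex_RInt_cont c _ _ Hc) (ex_RInt_cont c _ _ Hc)).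
  assert (E2 := RInt_Chasles (V := R_CompleteNormedModule) c 0 T (x + T)
                  (ex_RInt_cont c _ _ Hc) (ex_RInt_cont c _ _ Hc)).
  unfold plus in E1, E2; simpl in E1, E2.
  apply (Rplus_eq_reg_l (RInt c 0 x)). rewrite Rplus_comm, (Rplus_comm (RInt c 0 x)).
  rewrite <- E at 2. lra.
Qed.

(** * The translation number *)

(** Comparing u (m n) with both m u (n) and n u (m), and dividing by m n, shows that u (n) / n is a
    Cauchy sequence. *)
Lemma quasi_additive_lim (u : nat -> R) (C : R) :
  (forall m n, Rabs (u (m + n)%nat - u m - u n) <= C) ->
  ex_finite_lim_seq (fun n => u n / INR n).
Proof.
  intros Hu.
  assert (HC : 0 <= C) by (eapply Rle_trans; [apply Rabs_pos|apply (Hu 0 0)%nat]).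
  (* The multiplier starts at 1: for multiplier 0 the claim would be u 0 = 0, which quasi-additivity
     does not give. *)
  assert (Hk : forall k n, Rabs (u (S k * n)%nat - INR (S k) * u n) <= INR (S k) * C).
  { intros k n. induction k as [|k IH].
    - simpl. rewrite Nat.add_0_r. replace (u n - 1 * u n) with 0 by ring.
      rewrite Rabs_R0. lra.
    - replace (S (S k) * n)%nat with (S k * n + n)%nat by (simpl; lia).
      rewrite (S_INR (S k)).
      replace (u (S k * n + n)%nat - (INR (S k) + 1) * u n)
        with ((u (S k * n + n)%nat - u (S k * n)%nat - u n)
              + (u (S k * n)%nat - INR (S k) * u n)) by ring.
      eapply Rle_trans; [apply Rabs_triang|].
      specialize (Hu (S k * n)%nat n). lra. }
  assert (Hq : forall m n, (0 < m)%nat -> (0 < n)%nat ->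
             Rabs (u n / INR n - u m / INR m) <= C / INR n + C / INR m).
  { intros m n Hm Hn. destruct m as [|m]; [lia|]. destruct n as [|n]; [lia|].
    assert (Pm : 0 < INR (S m)) by (apply lt_0_INR; lia).
    assert (Pn : 0 < INR (S n)) by (apply lt_0_INR; lia).
    assert (H1 := Hk m (S n)). assert (H2 := Hk n (S m)).
    rewrite (Nat.mul_comm (S n) (S m)) in H2.
    set (v := u (S m * S n)%nat) in *. set (a := u (S n)) in *. set (b := u (S m)) in *.
    apply Rabs_le_between in H1. apply Rabs_le_between in H2.
    assert (Pmn : 0 < INR (S m) * INR (S n)) by now apply Rmult_lt_0_compat.
    apply Rabs_le.
    replace (a / INR (S n) - b / INR (S m))
      with ((INR (S m) * a - INR (S n) * b) / (INR (S m) * INR (S n))) by (field; lra).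
    replace (C / INR (S n) + C / INR (S m))
      with ((INR (S m) * C + INR (S n) * C) / (INR (S m) * INR (S n))) by (field; lra).
    split.
    - unfold Rdiv. rewrite Ropp_mult_distr_l. apply Rmult_le_compat_r; [|lra].
      left. now apply Rinv_0_lt_compat.
    - apply Rmult_le_compat_r; [|lra]. left. now apply Rinv_0_lt_compat. }
  apply ex_lim_seq_cauchy_corr. intros eps.
  destruct (nfloor_ex (2 * C / eps)) as [N [_ HN]].
  { apply Rdiv_le_0_compat; [lra|apply cond_pos]. }
  exists (S N). intros n m Hn Hm. assert (He := cond_pos eps).
  assert (B : forall k, (S N <= k)%nat -> C / INR k < eps / 2).
  { intros k Hk'. assert (INR (S N) <= INR k) by now apply le_INR.
    rewrite S_INR in H. assert (0 <= INR N) by apply pos_INR.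
    apply (Rmult_lt_reg_r (INR k)); [lra|].
    unfold Rdiv. rewrite (Rmult_assoc C), Rinv_l, Rmult_1_r by lra.
    assert (2 * C / eps * eps < INR k * eps) by (apply Rmult_lt_compat_r; lra).
    replace (2 * C / eps * eps) with (2 * C) in H1 by (field; lra). lra. }
  eapply Rle_lt_trans; [apply Hq; lia|].
  assert (B1 := B n Hn). assert (B2 := B m Hm). lra.
Qed.

Lemma lift_shift_Z (g : R -> R) (k : Z) (x : R) :
  (forall x, g (x + 2 * PI) = g x + 2 * PI) -> g (x + 2 * PI * IZR k) = g x + 2 * PI * IZR k.
Proof.
  intros Hg. assert (N : forall n y, g (y + 2 * PI * INR n) = g y + 2 * PI * INR n).
  { intros n. induction n as [|n IH]; intros y.
    - simpl. now rewrite Rmult_0_r, !Rplus_0_r.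
    - rewrite S_INR. replace (y + 2 * PI * (INR n + 1)) with (y + 2 * PI * INR n + 2 * PI) by ring.
      rewrite Hg, IH. ring. }
  destruct (Z_le_dec 0 k) as [Hk|Hk].
  - rewrite <- (Z2Nat.id k Hk), <- INR_IZR_INZ. apply N.
  - assert (E : IZR k = - INR (Z.to_nat (- k))).
    { rewrite INR_IZR_INZ, Z2Nat.id, opp_IZR by lia. ring. }
    rewrite E. assert (E1 := N (Z.to_nat (- k)) (x + 2 * PI * - INR (Z.to_nat (- k)))).
    replace (x + 2 * PI * - INR (Z.to_nat (- k)) + 2 * PI * INR (Z.to_nat (- k))) with x in E1
      by ring.
    lra.
Qed.

Section TranslationNumber.

Variable f : R -> R.
Hypotheses (Hcont : forall x, continuous f x) (Hper : forall x, f (x + 2 * PI) = f x + 2 * PI)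
  (Hinj : forall x y, f x = f y -> x = y).

(** Some translate z of x by full turns lies beyond y and has f z > f x. If f y <= f x, then f takes
    the value f x again on [y, z], against injectivity. *)
Lemma circle_lift_increasing (x y : R) : x < y -> f x < f y.
Proof.
  intros Hxy. assert (Hpi := PI_RGT_0).
  apply Rnot_le_lt. intros Hle.
  destruct (nfloor_ex (Rmax 0 ((y - x) / (2 * PI)))) as [n [_ Hn]]; [apply Rmax_l|].
  assert (Hb := Rmax_r 0 ((y - x) / (2 * PI))).
  set (z := x + 2 * PI * IZR (Z.of_nat (S n))).
  assert (Hz : y < z).
  { unfold z. rewrite <- INR_IZR_INZ, S_INR.
    assert (H : (y - x) / (2 * PI) * (2 * PI) < (INR n + 1) * (2 * PI))
      by (apply Rmult_lt_compat_r; lra).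
    replace ((y - x) / (2 * PI) * (2 * PI)) with (y - x) in H by (field; lra). lra. }
  assert (Hfz : f x < f z).
  { unfold z. rewrite (lift_shift_Z f) by exact Hper.
    rewrite <- INR_IZR_INZ, S_INR. assert (0 <= INR n) by apply pos_INR. nra. }
  destruct (IVT_gen f y z (f x)) as [w [Hw Ew]].
  - intros t. apply continuity_pt_filterlim, Hcont.
  - rewrite Rmin_left, Rmax_right by lra. lra.
  - rewrite Rmin_left, Rmax_right in Hw by lra. apply Hinj in Ew. lra.
Qed.

Lemma iter_lift_per (n : nat) (x : R) : Nat.iter n f (x + 2 * PI) = Nat.iter n f x + 2 * PI.
Proof. induction n as [|n IH]; simpl; [reflexivity|]. now rewrite IH, Hper. Qed.

Lemma iter_lift_le (n : nat) (x y : R) : x <= y -> Nat.iter n f x <= Nat.iter n f y.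
Proof.
  intros Hxy. induction n as [|n IH]; simpl; [exact Hxy|].
  destruct IH as [H|H]; [left; now apply circle_lift_increasing|rewrite H; lra].
Qed.

(** At multiples of 2 PI the displacement equals that at 0. Any x lies between two consecutive
    multiples, and monotonicity of the iterate bounds the discrepancy by one turn. *)
Lemma iter_displacement (n : nat) (x : R) :
  Rabs (Nat.iter n f x - x - Nat.iter n f 0) <= 2 * PI.
Proof.
  assert (Hpi := PI_RGT_0).
  destruct (floor_ex (x / (2 * PI))) as [k [Hk1 Hk2]].
  assert (K1 : 2 * PI * IZR k <= x).
  { replace x with (2 * PI * (x / (2 * PI))) by (field; lra). apply Rmult_le_compat_l; lra. }
  assert (K2 : x <= 2 * PI * IZR k + 2 * PI).
  { replace x with (2 * PI * (x / (2 * PI))) by (field; lra). nra. }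
  apply (iter_lift_le n) in K1. apply (iter_lift_le n) in K2.
  rewrite iter_lift_per in K2.
  assert (E := lift_shift_Z (Nat.iter n f) k 0 (iter_lift_per n)).
  rewrite Rplus_0_l in E. rewrite E in K1, K2.
  assert (K3 : 2 * PI * (x / (2 * PI)) = x) by (field; lra).
  apply Rabs_le. split; nra.
Qed.

Lemma translation_number_exists :
  exists rho : R, is_lim_seq (fun n => Nat.iter n f 0 / (2 * PI * INR n)) rho.
Proof.
  assert (Hpi := PI_RGT_0).
  destruct (quasi_additive_lim (fun n => Nat.iter n f 0) (2 * PI)) as [l Hl].
  - intros m n. rewrite Nat.iter_add.
    replace (Nat.iter m f (Nat.iter n f 0) - Nat.iter m f 0 - Nat.iter n f 0)
      with (Nat.iter m f (Nat.iter n f 0) - Nat.iter n f 0 - Nat.iter m f 0) by ring.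
    apply iter_displacement.
  - exists (/ (2 * PI) * l).
    apply (is_lim_seq_ext (fun n => / (2 * PI) * (Nat.iter n f 0 / INR n))).
    + intros n. change (/ (2 * PI) * (Nat.iter n f 0 * / INR n) = Nat.iter n f 0 * / (2 * PI * INR n)).
      rewrite (Rinv_mult (2 * PI)). ring.
    + apply (is_lim_seq_scal_l _ (/ (2 * PI)) l Hl).
Qed.

Lemma continuous_iter (n : nat) (x : R) : continuous (Nat.iter n f) x.
Proof.
  induction n as [|n IH]; simpl; [apply continuous_id|].
  apply (continuous_comp (Nat.iter n f) f); [exact IH|apply Hcont].
Qed.

End TranslationNumber.

(** * Integrals of periodic functions *)

Lemma continuous_bounded (f : R -> R) (a b : R) :
  a <= b -> (forall x, continuous f x) -> exists M, forall x, a <= x <= b -> Rabs (f x) <= M.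
Proof.
  intros Hab Hf.
  destruct (continuity_ab_maj (fun x => Rabs (f x)) a b Hab) as [m [Hm _]].
  - intros c _. apply continuity_pt_filterlim.
    apply (continuous_comp f Rabs); [apply Hf|apply continuous_Rabs].
  - exists (Rabs (f m)). exact Hm.
Qed.

(** The number I / (2 PI) is the mean of c; the primitive of c minus its mean is periodic and
    continuous, hence bounded. *)
Lemma RInt_periodic_linear (c : R -> R) (I : R) :
  (forall x, continuous c x) -> (forall x, c (x + 2 * PI) = c x) -> RInt c 0 (2 * PI) = I ->
  exists M, forall x y, Rabs (RInt c x y - I / (2 * PI) * (y - x)) <= M.
Proof.
  intros Hc Hper HI. assert (Hpi := PI_RGT_0).
  set (P := fun x => RInt c 0 x).
  assert (cP : forall x, continuous P x).
  { intros x. apply (is_derive_continuous _ _ (c x)).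
    apply (is_derive_RInt c P 0 x); [|apply Hc].
    apply filter_forall. intros z. apply (RInt_correct (V := R_CompleteNormedModule)).
    now apply ex_RInt_cont. }
  assert (Ch : forall x y, RInt c x y = P y - P x).
  { intros x y. assert (E := RInt_Chasles (V := R_CompleteNormedModule) c 0 x y
      (ex_RInt_cont c _ _ Hc) (ex_RInt_cont c _ _ Hc)).
    unfold plus in E; simpl in E. unfold P. lra. }
  destruct (continuous_bounded P 0 (2 * PI) ltac:(lra) cP) as [M HM].
  assert (B : forall x, Rabs (P x - I / (2 * PI) * x) <= M + Rabs I).
  { intros x. destruct (floor_ex (x / (2 * PI))) as [k [Hk1 Hk2]].
    assert (Hx : 2 * PI * (x / (2 * PI)) = x) by (field; lra).
    set (r := x - 2 * PI * IZR k).
    assert (Hr : 0 <= r <= 2 * PI) by (unfold r; split; nra).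
    assert (E : P x = P r + I * IZR k).
    { replace x with (r + 2 * PI * IZR k) by (unfold r; ring).
      assert (Z : forall z, P (z + 2 * PI) = P z + I).
      { intros z. assert (E := Ch z (z + 2 * PI)).
        rewrite RInt_periodic in E by assumption. lra. }
      (* [P] advances by I over a period. The added linear term raises this to 2 PI, so that
         [lift_shift_Z] applies. *)
      assert (Q : P (r + 2 * PI * IZR k) + (r + 2 * PI * IZR k) * (1 - I / (2 * PI))
                  = P r + r * (1 - I / (2 * PI)) + 2 * PI * IZR k).
      { apply (lift_shift_Z (fun z => P z + z * (1 - I / (2 * PI)))).
        intros z. rewrite Z. field. lra. }
      apply (Rplus_eq_reg_r ((r + 2 * PI * IZR k) * (1 - I / (2 * PI)))).
      rewrite Q. field. lra. }
    rewrite E.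
    replace (P r + I * IZR k - I / (2 * PI) * x) with (P r + - (I * (r / (2 * PI))))
      by (unfold r; field; lra).
    eapply Rle_trans; [apply Rabs_triang|]. rewrite Rabs_Ropp, Rabs_mult.
    assert (Hr1 : 0 <= r / (2 * PI) <= 1).
    { split; [apply Rdiv_le_0_compat; lra|].
      apply (Rmult_le_reg_r (2 * PI)); [lra|].
      unfold Rdiv. rewrite Rmult_assoc, Rinv_l; lra. }
    rewrite (Rabs_pos_eq (r / (2 * PI))) by lra.
    assert (H1 := HM r Hr). assert (H2 := Rabs_pos I). nra. }
  exists (2 * (M + Rabs I)). intros x y. rewrite Ch.
  replace (P y - P x - I / (2 * PI) * (y - x))
    with ((P y - I / (2 * PI) * y) + - (P x - I / (2 * PI) * x)) by ring.
  eapply Rle_trans; [apply Rabs_triang|]. rewrite Rabs_Ropp.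
  assert (H1 := B x). assert (H2 := B y). lra.
Qed.

(** * Area-preserving maps and the boundary form *)

(* Coquelicot often types equalities of reals in a structure carrier unfolding to [R],
   which [ring] and [field] do not recognize. *)
Ltac eq_R := match goal with |- @eq _ ?x ?y => change (@eq R x y) end.

Lemma RInt_ext_R (f g : R -> R) (a b : R) : (forall x, f x = g x) -> RInt f a b = RInt g a b.
Proof. intros H. apply RInt_ext. intros x _. apply H. Qed.

Lemma cont3_plus F G : cont3 F -> cont3 G -> cont3 (fun t x y => F t x y + G t x y).
Proof. intros HF HG t x y. apply (continuous_plus (V := R_NormedModule)); auto. Qed.

Lemma cont3_mult F G : cont3 F -> cont3 G -> cont3 (fun t x y => F t x y * G t x y).
Proof. intros HF HG t x y. apply (continuous_mult (K := R_AbsRing)); auto. Qed.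

Lemma cont3_opp F : cont3 F -> cont3 (fun t x y => - F t x y).
Proof. intros HF t x y. apply (continuous_opp (V := R_NormedModule)); auto. Qed.

Lemma cont3_minus F G : cont3 F -> cont3 G -> cont3 (fun t x y => F t x y - G t x y).
Proof. intros HF HG t x y. apply (continuous_minus (V := R_NormedModule)); auto. Qed.

Lemma cont3_comp2 (f : R -> R -> R) u v : cont3 (fun _ => f) -> cont3 u -> cont3 v ->
  cont3 (fun t x y => f (u t x y) (v t x y)).
Proof.
  intros Hf Hu Hv t x y.
  apply (cont3_comp (fun _ => f) (fun _ => 0)
    (fun p : R * R * R => u (fst (fst p)) (snd (fst p)) (snd p))
    (fun p => v (fst (fst p)) (snd (fst p)) (snd p)) _ Hf); auto.
  apply continuous_const.
Qed.

Lemma cont3_slice_t F t x y : cont3 F -> continuous (fun s => F s x y) t.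
Proof.
  intros HF. apply (cont3_comp F (fun s => s) (fun _ => x) (fun _ => y) t HF);
    [apply continuous_id|apply continuous_const..].
Qed.

Ltac cont3_tac :=
  repeat first
    [ assumption
    | match goal with
      | |- cont3 (fun _ _ _ => _ + _) => apply cont3_plus
      | |- cont3 (fun _ _ _ => _ * _) => apply cont3_mult
      | |- cont3 (fun _ _ _ => - _) => apply cont3_opp
      | |- cont3 (fun _ _ _ => _ - _) => apply cont3_minus
      | H : cont3 ?F |- cont3 (fun _ => ?F _) => apply cont3_freeze, H
      | H : cont3 ?F |- cont3 (fun _ x y => ?F _ x y) => apply (cont3_freeze F), H
      | H : cont3 (fun _ => ?f) |- cont3 (fun t x y => ?f _ _) => apply (cont3_comp2 f)
      | H : cont3 (fun _ x y => ?f (x, y)) |- cont3 (fun t x y => ?f (_, _)) =>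
          apply (cont3_comp2 (fun x y => f (x, y)))
      end ].

(* [simpl] turns the binder type of the differentiated function from the carrier of [R_AbsRing]
   into [R]; without it the rewriting fails. *)
Ltac rewrite_Derive_in H J :=
  let E := fresh in assert (E := is_derive_unique _ _ _ H); simpl in E; rewrite E in J; clear E.

Ltac rewrite_Derive H :=
  let E := fresh in assert (E := is_derive_unique _ _ _ H); simpl in E; rewrite E; clear E.

Lemma C1_partials (f : R -> R -> R) : Cn 1 (fun _ => f) ->
  exists fx fy : R -> R -> R,
    (forall x y, is_derive (fun z => f z y) x (fx x y)) /\
    (forall x y, is_derive (fun z => f x z) y (fy x y)) /\
    cont3 (fun _ => f) /\ cont3 (fun _ => fx) /\ cont3 (fun _ => fy).
Proof.
  intros [c (ft & fx & fy & H1 & H2 & H3 & [H4 _] & [H5 _] & [H6 _])].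
  exists (fx 0), (fy 0).
  split; [exact (H2 0)|]. split; [exact (H3 0)|]. split; [exact c|].
  split; now apply cont3_freeze.
Qed.

Lemma C2_partials (f : R -> R -> R) : Cn 2 (fun _ => f) ->
  exists fx fy fxy : R -> R -> R,
    (forall x y, is_derive (fun z => f z y) x (fx x y)) /\
    (forall x y, is_derive (fun z => f x z) y (fy x y)) /\
    (forall x y, is_derive (fun z => fx x z) y (fxy x y)) /\
    (forall x y, is_derive (fun z => fy z y) x (fxy x y)) /\
    cont3 (fun _ => f) /\ Cn 1 (fun _ => fx) /\ Cn 1 (fun _ => fy) /\ cont3 (fun _ => fxy).
Proof.
  intros Hf. assert (c := Cn_cont3 _ _ Hf).
  destruct (C2_mixed _ Hf) as (ft & fx & fy & ftx & fty & fxy & H1 & H2 & H3 & H4 & H5 & H6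
    & H7 & H8 & H9 & H10 & H11 & H12 & H13 & H14 & H15).
  exists (fx 0), (fy 0), (fxy 0).
  assert (fr : forall n F, Cn n F -> Cn n (fun _ => F 0)).
  { intros n F HF. apply (Cn_comp n F (fun _ _ _ => 0) (fun _ x _ => x) (fun _ _ y => y));
      [exact HF|apply Cn_const|apply Cn_x|apply Cn_y]. }
  split; [exact (H2 0)|]. split; [exact (H3 0)|]. split; [exact (H11 0)|].
  split; [exact (H12 0)|]. split; [exact c|]. split; [now apply fr|].
  split; [now apply fr|now apply cont3_freeze].
Qed.

(* Change of variables without the change of variables formula: with [A_y = f], pulling back
   [- A dx] and applying Green's formula on both sides leaves a line integral over the circle,
   which only depends on the degree of the boundary map. *)
Lemma int_D_comp (f g1 g2 : R -> R -> R) (phi : R -> R) :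
  Cn 1 (fun _ => f) -> Cn 2 (fun _ => g1) -> Cn 2 (fun _ => g2) ->
  (forall x, continuous phi x) -> phi (2 * PI) = phi 0 + 2 * PI ->
  (forall th, g1 (cos th) (sin th) = cos (phi th) /\ g2 (cos th) (sin th) = sin (phi th)) ->
  (forall p, inD p -> jac_det (fun p => (g1 (fst p) (snd p), g2 (fst p) (snd p))) p = 1) ->
  int_D (fun p => f (g1 (fst p) (snd p)) (g2 (fst p) (snd p)))
  = int_D (fun p => f (fst p) (snd p)).
Proof.
  intros Hf Hg1 Hg2 Hphi Hdeg Hon Hjac. assert (Hpi := PI_RGT_0).
  destruct (C1_partials f Hf) as (fx & fy & dfx & dfy & cf & cfx & cfy).
  destruct (C2_partials g1 Hg1) as (g1x & g1y & g1xy & d1x & d1y & d1xy & d1yx & c1 & k1x & k1y & c1xy).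
  destruct (C2_partials g2 Hg2) as (g2x & g2y & g2xy & d2x & d2y & _ & _ & c2 & k2x & k2y & _).
  assert (c1x := Cn_cont3 _ _ k1x). assert (c1y := Cn_cont3 _ _ k1y).
  assert (c2x := Cn_cont3 _ _ k2x). assert (c2y := Cn_cont3 _ _ k2y).
  set (A := vprim (fun _ => f) 0). set (Ax := vprim (fun _ => fx) 0).
  assert (cA : cont3 (fun _ => A)) by (apply cont3_freeze, vprim_cont3, cf).
  assert (cAx : cont3 (fun _ => Ax)) by (apply cont3_freeze, vprim_cont3, cfx).
  assert (dAy : forall x y, is_derive (fun z => A x z) y (f x y)) by (intros; now apply vprim_dy).
  assert (dAx : forall x y, is_derive (fun z => A z y) x (Ax x y)).
  { intros x y. apply (vprim_dx (fun _ => f) (fun _ => fx)); auto. }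
  (* The pullback of - A dx. In its exterior derivative the mixed terms and the [Ax] terms cancel,
     and what remains is f o g times the Jacobian determinant. *)
  assert (G := green_disk (fun x y => - A (g1 x y) (g2 x y) * g1x x y)
                 (fun x y => - A (g1 x y) (g2 x y) * g1y x y)
    (fun x y => - (Ax (g1 x y) (g2 x y) * g1y x y + f (g1 x y) (g2 x y) * g2y x y) * g1x x y
                + - A (g1 x y) (g2 x y) * g1xy x y)
    (fun x y => - (Ax (g1 x y) (g2 x y) * g1x x y + f (g1 x y) (g2 x y) * g2x x y) * g1y x y
                + - A (g1 x y) (g2 x y) * g1xy x y)).
  (* The summand with factor 0 is the dy component of - A dx, kept to match the shape of
     [line_integral_lift]. *)
  transitivity (RInt (fun th => - A (g1 (cos th) (sin th)) (g2 (cos th) (sin th)) *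
      (g1x (cos th) (sin th) * - sin th + g1y (cos th) (sin th) * cos th)
      + 0 * (g2x (cos th) (sin th) * - sin th + g2y (cos th) (sin th) * cos th)) 0 (2 * PI)).
  - transitivity (RInt (fun th => (- A (g1 (cos th) (sin th)) (g2 (cos th) (sin th)) * g1x (cos th) (sin th)) * - sin th
      + (- A (g1 (cos th) (sin th)) (g2 (cos th) (sin th)) * g1y (cos th) (sin th)) * cos th) 0 (2 * PI)).
    + rewrite <- G; try cont3_tac.
      * apply int_D_ext. intros x y Hxy. simpl.
        assert (J := Hjac (x, y) (Rlt_le _ _ Hxy)).
        change (Derive (fun s => g1 s y) x * Derive (fun s => g2 x s) y
                - Derive (fun s => g1 x s) y * Derive (fun s => g2 s y) x = 1) in J.
        rewrite_Derive_in (d1x x y) J. rewrite_Derive_in (d1y x y) J.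
        rewrite_Derive_in (d2x x y) J. rewrite_Derive_in (d2y x y) J.
        transitivity (f (g1 x y) (g2 x y) * (g1x x y * g2y x y - g1y x y * g2x x y));
          [rewrite J|]; ring.
      * intros x y. apply (is_derive_mult_R (fun z => - A (g1 z y) (g2 z y)) (fun z => g1y z y));
          [|apply d1yx].
        apply (is_derive_opp (V := R_NormedModule)).
        now apply (is_derive_comp2 A Ax f (fun z => g1 z y) (fun z => g2 z y)).
      * intros x y. apply (is_derive_mult_R (fun z => - A (g1 x z) (g2 x z)) (fun z => g1x x z));
          [|apply d1xy].
        apply (is_derive_opp (V := R_NormedModule)).
        now apply (is_derive_comp2 A Ax f (fun z => g1 x z) (fun z => g2 x z)).
    + apply RInt_ext_R. intros th. ring.
  - assert (L := line_integral_lift (fun th => g1 (cos th) (sin th)) (fun th => g2 (cos th) (sin th))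
      (fun th => g1x (cos th) (sin th) * - sin th + g1y (cos th) (sin th) * cos th)
      (fun th => g2x (cos th) (sin th) * - sin th + g2y (cos th) (sin th) * cos th)
      phi 0 (2 * PI)).
    assert (cc : forall hx hy : R -> R -> R, cont3 (fun _ => hx) -> cont3 (fun _ => hy) -> forall th,
       continuous (fun th => hx (cos th) (sin th) * - sin th + hy (cos th) (sin th) * cos th) th).
    { intros hx hy Hx Hy th. apply (continuous_plus (V := R_NormedModule));
        apply (continuous_mult (K := R_AbsRing)).
      - apply (cont3_circle (fun _ => hx) 0 th Hx).
      - apply (continuous_opp (V := R_NormedModule)), continuous_sin.
      - apply (cont3_circle (fun _ => hy) 0 th Hy).
      - apply continuous_cos. }
    rewrite (L ltac:(lra)) with (P := fun x y => - A x y) (Q := fun _ _ => 0).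
    (* Degree one: the lift sweeps exactly one period, and by periodicity its starting angle does
       not matter. *)
    + rewrite Hdeg.
      assert (cm : forall th, continuous
         (fun th => - A (cos th) (sin th) * - sin th + 0 * cos th) th).
      { apply (cc (fun x y => - A x y) (fun _ _ => 0)); [cont3_tac|].
        intros ? ? ?; apply continuous_const. }
      rewrite RInt_periodic.
      * rewrite (int_D_dy A f) by assumption. apply RInt_ext_R. intros th. ring.
      * exact cm.
      * intros th. now rewrite cos_plus, sin_plus, cos_2PI, sin_2PI, !Rmult_0_r, !Rmult_1_r, Rminus_0_r, Rplus_0_r.
    + intros th. now apply is_derive_on_circle.
    + intros th. now apply is_derive_on_circle.
    + now apply cc.
    + now apply cc.
    + exact Hphi.
    + intros th _. apply Hon.
    + cont3_tac.
    + intros ? ? ?; apply continuous_const.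
Qed.

(** The integrand is h omega - dh /\ eta. Since h vanishes on the circle, Stokes for d (h eta) = dh
    /\ eta + h omega shows that the second term contributes another integral of h. *)
Lemma int_D_hamiltonian (a b h hx hy : R -> R -> R) :
  Cn 1 (fun _ => a) -> Cn 1 (fun _ => b) ->
  (forall x y, is_derive (fun z => h z y) x (hx x y)) ->
  (forall x y, is_derive (fun z => h x z) y (hy x y)) ->
  cont3 (fun _ => h) -> cont3 (fun _ => hx) -> cont3 (fun _ => hy) ->
  (forall x y, inD (x, y) -> Derive (fun z => b z y) x - Derive (fun z => a x z) y = 1) ->
  (forall th, h (cos th) (sin th) = 0) ->
  int_D (fun p => h (fst p) (snd p) + a (fst p) (snd p) * hy (fst p) (snd p)
                  - b (fst p) (snd p) * hx (fst p) (snd p))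
  = 2 * int_D (fun p => h (fst p) (snd p)).
Proof.
  intros Ha Hb dhx dhy ch chx chy Hab Hbd.
  destruct (C1_partials a Ha) as (ax & ay & dax & day & ca & cax & cay).
  destruct (C1_partials b Hb) as (bx & by' & dbx & dby & cb & cbx & cby).
  assert (G := green_disk (fun x y => a x y * h x y) (fun x y => b x y * h x y)
    (fun x y => ay x y * h x y + a x y * hy x y) (fun x y => bx x y * h x y + b x y * hx x y)).
  rewrite (RInt_ext_R _ (fun _ => 0)) in G.
  2:{ intros th. rewrite Hbd. ring. }
  rewrite RInt_const in G. unfold scal in G; simpl in G; unfold mult in G; simpl in G.
  rewrite Rmult_0_r in G.
  (* The coefficient of d (h eta); on D the integrand is 2 h - r. *)
  pose (r := fun x y => bx x y * h x y + b x y * hx x y - (ay x y * h x y + a x y * hy x y)).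
  transitivity (2 * int_D (fun p => h (fst p) (snd p)) + -1 * int_D (fun p => r (fst p) (snd p))).
  - rewrite <- (int_D_lin h r) by (unfold r; cont3_tac).
    unfold r. apply int_D_ext. intros x y Hxy. simpl.
    assert (J := Hab x y (Rlt_le _ _ Hxy)).
    rewrite_Derive_in (dbx x y) J. rewrite_Derive_in (day x y) J.
    replace (bx x y) with (1 + ay x y) by lra. ring.
  - unfold r. rewrite G; try cont3_tac.
    + ring.
    + intros x y. now apply (is_derive_mult_R (fun z => b z y) (fun z => h z y)).
    + intros x y. now apply (is_derive_mult_R (fun z => a x z) (fun z => h x z)).
Qed.

Definition circle_form (a b : R * R -> R) (th : R) : R :=
  a (cos th, sin th) * - sin th + b (cos th, sin th) * cos th.

Lemma circle_form_continuous (a b : R * R -> R) (th : R) :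
  cont3 (fun _ x y => a (x, y)) -> cont3 (fun _ x y => b (x, y)) ->
  continuous (circle_form a b) th.
Proof.
  intros Ha Hb. apply (continuous_plus (V := R_NormedModule));
    apply (continuous_mult (K := R_AbsRing)).
  - apply (cont3_circle (fun _ x y => a (x, y)) 0 th Ha).
  - apply (continuous_opp (V := R_NormedModule)), continuous_sin.
  - apply (cont3_circle (fun _ x y => b (x, y)) 0 th Hb).
  - apply continuous_cos.
Qed.

Lemma circle_form_periodic (a b : R * R -> R) (th : R) :
  circle_form a b (th + 2 * PI) = circle_form a b th.
Proof.
  unfold circle_form. rewrite cos_plus, sin_plus, cos_2PI, sin_2PI.
  now rewrite !Rmult_0_r, !Rmult_1_r, Rminus_0_r, Rplus_0_r.
Qed.

(** Stokes gives the area of D; Green's formula for y turns the area into the integral of sin^2. *)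
Lemma RInt_circle_form (a b : R * R -> R) :
  is_primitive_omega a b -> RInt (circle_form a b) 0 (2 * PI) = PI.
Proof.
  intros [Ha [Hb Hab]].
  destruct (C1_partials (fun x y => a (x, y)) (smooth3_Cn 1 _ Ha))
    as (ax & ay & dax & day & ca & cax & cay).
  destruct (C1_partials (fun x y => b (x, y)) (smooth3_Cn 1 _ Hb))
    as (bx & by' & dbx & dby & cb & cbx & cby).
  unfold circle_form.
  rewrite <- (green_disk (fun x y => a (x, y)) (fun x y => b (x, y)) ay bx) by assumption.
  transitivity (int_D (fun p => (fun _ _ => 1) (fst p) (snd p))).
  { apply int_D_ext. intros x y Hxy. simpl.
    assert (J := Hab (x, y) (Rlt_le _ _ Hxy)).
    change (Derive (fun s => b (s, y)) x - Derive (fun s => a (x, s)) y = 1) in J.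
    rewrite_Derive_in (dbx x y) J. rewrite_Derive_in (day x y) J. now symmetry. }
  rewrite (int_D_dy (fun _ y => y) (fun _ _ => 1)).
  - rewrite (RInt_derive_R (fun th => (th - sin th * cos th) / 2)).
    + rewrite sin_2PI, sin_0. eq_R. field.
    + intros th. auto_derive; [exact I|].
      assert (H := sin2_cos2 th). unfold Rsqr in H. nra.
    + intros th. apply (continuous_mult (K := R_AbsRing)); apply continuous_sin.
  - intros x y. apply (is_derive_id (K := R_AbsRing)).
  - apply (Cn_cont3 0), Cn_y.
  - apply (Cn_cont3 0), Cn_const.
Qed.

(** * Variation of tau along an isotopy *)

(** Time is moved to the last slot, the one in which [vprim] integrates. *)
Lemma cont3_circle_t (F : R -> R -> R -> R) :
  cont3 F -> cont3 (fun _ th t => F t (cos th) (sin th)).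
Proof.
  intros HF u th t.
  assert (cth : continuous (fun p : R * R * R => snd (fst p)) (u, th, t)).
  { apply (continuous_comp fst snd); [apply continuous_fst|apply continuous_snd]. }
  apply (cont3_comp F (fun p : R * R * R => snd p) (fun p => cos (snd (fst p)))
    (fun p => sin (snd (fst p))) _ HF).
  - apply continuous_snd.
  - apply (continuous_comp (fun p : R * R * R => snd (fst p)) cos); [exact cth|apply continuous_cos].
  - apply (continuous_comp (fun p : R * R * R => snd (fst p)) sin); [exact cth|apply continuous_sin].
Qed.

Section Isotopy.

(** The pair (G1, G2) abstracts F t o g^n. The path need not start at the identity, and the
    geometric conditions are asked only for t in [0, 1] and on D or its boundary. *)
Variables (G1 G2 : R -> R -> R -> R) (a b : R * R -> R) (H : R -> R * R -> R) (Psi : R -> R -> R).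
Hypotheses (HG1 : Cn 2 G1) (HG2 : Cn 2 G2) (Hab : is_primitive_omega a b)
  (HH : forall t, 0 <= t <= 1 -> smooth2 (fun x y => H t (x, y)))
  (Hbd : forall t p, 0 <= t <= 1 -> onS1 p -> H t p = 0)
  (HD : forall t x y, 0 <= t <= 1 -> inD (x, y) -> inD (G1 t x y, G2 t x y))
  (Hjac : forall t p, 0 <= t <= 1 -> inD p ->
     jac_det (fun p => (G1 t (fst p) (snd p), G2 t (fst p) (snd p))) p = 1)
  (Hham : forall t x y, 0 <= t <= 1 -> inD (x, y) ->
     dx (H t) (G1 t x y, G2 t x y) = - Derive (fun s => G2 s x y) t /\
     dy (H t) (G1 t x y, G2 t x y) = Derive (fun s => G1 s x y) t)
  (HPt : forall t th, continuous (fun s => Psi s th) t)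
  (HPth : forall t th, continuous (Psi t) th)
  (Hlift : forall t th, 0 <= t <= 1 ->
     G1 t (cos th) (sin th) = cos (Psi t th) /\ G2 t (cos th) (sin th) = sin (Psi t th))
  (Hdeg : forall t, 0 <= t <= 1 -> Psi t (2 * PI) = Psi t 0 + 2 * PI).


(* Cartan's formula: the pulled back form has derivative [dK] with [K = eta(X) + H] transported
   by [G], and [int_D dK /\ eta] is a boundary term minus [int_D K = 2 int_D H]. *)
Lemma tau_isotopy :
  tau a b (fun p => (G1 1 (fst p) (snd p), G2 1 (fst p) (snd p)))
  - tau a b (fun p => (G1 0 (fst p) (snd p), G2 0 (fst p) (snd p)))
  = RInt (fun th => RInt (circle_form a b) (Psi 0 th) (Psi 1 th) * circle_form a b th) 0 (2 * PI)
    - 2 * Rcal H.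
Proof.
  assert (Hpi := PI_RGT_0).
  destruct Hab as [Ha [Hb Hd]].
  assert (Ka := smooth3_Cn 1 _ Ha). assert (Kb := smooth3_Cn 1 _ Hb).
  destruct (C1_partials (fun x y => a (x, y)) Ka) as (ax & ay & dax & day & ca & cax & cay).
  destruct (C1_partials (fun x y => b (x, y)) Kb) as (bx & by' & dbx & dby & cb & cbx & cby).
  assert (cG1 := Cn_cont3 _ _ HG1). assert (cG2 := Cn_cont3 _ _ HG2).
  destruct (C2_mixed G1 HG1) as (G1t & G1x & G1y & G1tx & G1ty & G1xy &
    d1t & d1x & d1y & k1t & k1x & k1y & d1tx & d1xt & d1ty & d1yt & d1xy & d1yx & c1tx & c1ty & c1xy).
  destruct (C2_mixed G2 HG2) as (G2t & G2x & G2y & G2tx & G2ty & G2xy &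
    d2t & d2x & d2y & k2t & k2x & k2y & d2tx & d2xt & d2ty & d2yt & d2xy & d2yx & c2tx & c2ty & c2xy).
  assert (c1t := Cn_cont3 _ _ k1t). assert (c1x := Cn_cont3 _ _ k1x).
  assert (c1y := Cn_cont3 _ _ k1y). assert (c2t := Cn_cont3 _ _ k2t).
  assert (c2x := Cn_cont3 _ _ k2x). assert (c2y := Cn_cont3 _ _ k2y).
  assert (curl : forall x y, inD (x, y) -> bx x y = 1 + ay x y).
  { intros x y Hxy. assert (J := Hd (x, y) Hxy).
    change (Derive (fun s => b (s, y)) x - Derive (fun s => a (x, s)) y = 1) in J.
    rewrite_Derive_in (dbx x y) J. rewrite_Derive_in (day x y) J. lra. }
  set (aG := fun t x y => a (G1 t x y, G2 t x y)).
  set (bG := fun t x y => b (G1 t x y, G2 t x y)).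
  set (axG := fun t x y => ax (G1 t x y) (G2 t x y)).
  set (ayG := fun t x y => ay (G1 t x y) (G2 t x y)).
  set (bxG := fun t x y => bx (G1 t x y) (G2 t x y)).
  set (byG := fun t x y => by' (G1 t x y) (G2 t x y)).
  assert (caG : cont3 aG) by (unfold aG; cont3_tac).
  assert (cbG : cont3 bG) by (unfold bG; cont3_tac).
  assert (caxG : cont3 axG) by (unfold axG; cont3_tac).
  assert (cayG : cont3 ayG) by (unfold ayG; cont3_tac).
  assert (cbxG : cont3 bxG) by (unfold bxG; cont3_tac).
  assert (cbyG : cont3 byG) by (unfold byG; cont3_tac).
  assert (daGt : forall t x y, is_derive (fun s => aG s x y) t
            (axG t x y * G1t t x y + ayG t x y * G2t t x y)).
  { intros. now apply (is_derive_comp2 (fun x y => a (x, y)) ax ay (fun s => G1 s x y) (fun s => G2 s x y)). }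
  assert (dbGt : forall t x y, is_derive (fun s => bG s x y) t
            (bxG t x y * G1t t x y + byG t x y * G2t t x y)).
  { intros. now apply (is_derive_comp2 (fun x y => b (x, y)) bx by' (fun s => G1 s x y) (fun s => G2 s x y)). }
  assert (daGx : forall t x y, is_derive (fun s => aG t s y) x
            (axG t x y * G1x t x y + ayG t x y * G2x t x y)).
  { intros. now apply (is_derive_comp2 (fun x y => a (x, y)) ax ay (fun s => G1 t s y) (fun s => G2 t s y)). }
  assert (dbGx : forall t x y, is_derive (fun s => bG t s y) x
            (bxG t x y * G1x t x y + byG t x y * G2x t x y)).
  { intros. now apply (is_derive_comp2 (fun x y => b (x, y)) bx by' (fun s => G1 t s y) (fun s => G2 t s y)). }
  assert (daGy : forall t x y, is_derive (fun s => aG t x s) y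
            (axG t x y * G1y t x y + ayG t x y * G2y t x y)).
  { intros. now apply (is_derive_comp2 (fun x y => a (x, y)) ax ay (fun s => G1 t x s) (fun s => G2 t x s)). }
  assert (dbGy : forall t x y, is_derive (fun s => bG t x s) y
            (bxG t x y * G1y t x y + byG t x y * G2y t x y)).
  { intros. now apply (is_derive_comp2 (fun x y => b (x, y)) bx by' (fun s => G1 t x s) (fun s => G2 t x s)). }
  set (k := fun t x y => (aG t x y * G1x t x y + bG t x y * G2x t x y) * b (x, y)
                         - (aG t x y * G1y t x y + bG t x y * G2y t x y) * a (x, y)).
  (* [Pt] and [Qt] are the components of the time derivative of G_t^* eta, and [k] above is the
     integrand of tau (G_t). *)
  set (Pt := fun t x y =>
     (axG t x y * G1t t x y + ayG t x y * G2t t x y) * G1x t x y + aG t x y * G1tx t x y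
     + ((bxG t x y * G1t t x y + byG t x y * G2t t x y) * G2x t x y + bG t x y * G2tx t x y)).
  set (Qt := fun t x y =>
     (axG t x y * G1t t x y + ayG t x y * G2t t x y) * G1y t x y + aG t x y * G1ty t x y
     + ((bxG t x y * G1t t x y + byG t x y * G2t t x y) * G2y t x y + bG t x y * G2ty t x y)).
  assert (cPt : cont3 Pt) by (unfold Pt; cont3_tac).
  assert (cQt : cont3 Qt) by (unfold Qt; cont3_tac).
  set (k' := fun t x y => Pt t x y * b (x, y) - Qt t x y * a (x, y)).
  assert (ck : cont3 k) by (unfold k; cont3_tac).
  assert (ck' : cont3 k') by (unfold k'; cont3_tac).
  assert (dk : forall t x y, is_derive (fun s => k s x y) t (k' t x y)).
  { intros t x y.
    assert (S : forall (f : R -> R) (c f' : R), is_derive f t f' ->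
                 is_derive (fun s => f s * c) t (f' * c)).
    { intros f c f' Hf. rewrite (Rmult_comm f').
      apply (is_derive_ext (fun s => c * f s)); [intros; apply Rmult_comm|].
      now apply (is_derive_scal f). }
    apply (is_derive_minus (V := R_NormedModule)); apply S;
      apply (is_derive_plus (V := R_NormedModule)).
    - now apply (is_derive_mult_R (fun s => aG s x y) (fun s => G1x s x y)).
    - now apply (is_derive_mult_R (fun s => bG s x y) (fun s => G2x s x y)).
    - now apply (is_derive_mult_R (fun s => aG s x y) (fun s => G1y s x y)).
    - now apply (is_derive_mult_R (fun s => bG s x y) (fun s => G2y s x y)). }
  set (T := fun t => int_D (fun p => k t (fst p) (snd p))).
  set (T' := fun t => int_D (fun p => k' t (fst p) (snd p))).
  assert (HT : forall t, tau a b (fun p => (G1 t (fst p) (snd p), G2 t (fst p) (snd p))) = T t).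
  { intros t. apply int_D_ext. intros x y _.
    transitivity ((a (G1 t x y, G2 t x y) * Derive (fun s => G1 t s y) x
                   + b (G1 t x y, G2 t x y) * Derive (fun s => G2 t s y) x) * b (x, y)
                - (a (G1 t x y, G2 t x y) * Derive (fun s => G1 t x s) y
                   + b (G1 t x y, G2 t x y) * Derive (fun s => G2 t x s) y) * a (x, y)).
    { reflexivity. }
    assert (E1 := is_derive_unique _ _ _ (d1x t x y)). assert (E2 := is_derive_unique _ _ _ (d2x t x y)).
    assert (E3 := is_derive_unique _ _ _ (d1y t x y)). assert (E4 := is_derive_unique _ _ _ (d2y t x y)).
    simpl in E1, E2, E3, E4. rewrite E1, E2, E3, E4. reflexivity. }
  rewrite !HT.
  assert (cT' : forall t, continuous T' t) by (intros; now apply continuous_int_D).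
  rewrite <- (RInt_derive_R T T' 0 1); [|intros; now apply is_derive_int_D|exact cT'].
  (* [M] is eta (X_t) transported to the source by G_t. *)
  set (M := fun t x y => aG t x y * G1t t x y + bG t x y * G2t t x y).
  assert (cM : cont3 M) by (unfold M; cont3_tac).
  set (c := circle_form a b).
  assert (cc : forall th, continuous c th) by (intros; now apply circle_form_continuous).
  set (m := fun _ th t : R => M t (cos th) (sin th)).
  assert (cm : cont3 m) by now apply cont3_circle_t.
  set (B := fun t => RInt (fun th => m 0 th t * c th) 0 (2 * PI)).
  (* [S] accumulates the boundary term up to time t. Since S' = B and S 0 = 0, the integral of [B]
     over [0, 1] is S 1, with the time integral already inside; this takes the place of Fubini. *)
  set (S := fun t => RInt (fun th => vprim m 0 th t * c th) 0 (2 * PI)).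
  assert (cB : forall t, continuous B t).
  { intros t. apply (continuous_RInt_fiber (fun th t => m 0 th t * c th)); [lra|].
    intros th s. apply (continuous_mult (K := R_AbsRing)).
    - apply (cont3_comp m (fun _ => 0) fst snd _ cm);
        [apply continuous_const|apply continuous_fst|apply continuous_snd].
    - apply (continuous_comp fst c); [apply continuous_fst|apply cc]. }
  assert (dS : forall t, is_derive S t (B t)).
  { intros t. apply (is_derive_RInt_fiber (fun t th => vprim m 0 th t * c th)
                       (fun t th => m 0 th t * c th)).
    - intros s th. rewrite (Rmult_comm (m 0 th s)).
      apply (is_derive_ext (fun s => c th * vprim m 0 th s)); [intros; apply Rmult_comm|].
      apply (is_derive_scal (fun s => vprim m 0 th s)). now apply vprim_dy.
    - intros s th. apply (continuous_mult (K := R_AbsRing)).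
      + apply (cont3_comp m (fun _ => 0) snd fst _ cm);
          [apply continuous_const|apply continuous_snd|apply continuous_fst].
      + apply (continuous_comp snd c); [apply continuous_snd|apply cc].
    - intros s th. apply (continuous_mult (K := R_AbsRing)); [|apply cc].
      apply (cont3_comp (vprim m) (fun _ => 0) (fun th => th) (fun _ => s) th);
        [now apply vprim_cont3|apply continuous_const|apply continuous_id|apply continuous_const]. }
  assert (HT' : forall t, 0 <= t <= 1 -> T' t = B t - 2 * int_D (H t)).
  { intros t Ht.
    set (h := fun x y => H t (x, y)).
    destruct (C2_partials h (smooth3_Cn 2 _ (HH t Ht)))
      as (hx & hy & hxy & dhx & dhy & _ & _ & ch & khx & khy & _).
    assert (chx := Cn_cont3 _ _ khx). assert (chy := Cn_cont3 _ _ khy).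
    assert (hamx : forall x y, inD (x, y) -> hx (G1 t x y) (G2 t x y) = - G2t t x y).
    { intros x y Hxy. destruct (Hham t x y Ht Hxy) as [J _].
      change (Derive (fun s => h s (G2 t x y)) (G1 t x y) = - Derive (fun s => G2 s x y) t) in J.
      rewrite_Derive_in (dhx (G1 t x y) (G2 t x y)) J. rewrite_Derive_in (d2t t x y) J. exact J. }
    assert (hamy : forall x y, inD (x, y) -> hy (G1 t x y) (G2 t x y) = G1t t x y).
    { intros x y Hxy. destruct (Hham t x y Ht Hxy) as [_ J].
      change (Derive (fun s => h (G1 t x y) s) (G2 t x y) = Derive (fun s => G1 s x y) t) in J.
      rewrite_Derive_in (dhy (G1 t x y) (G2 t x y)) J. rewrite_Derive_in (d1t t x y) J. exact J. }
    assert (hS1 : forall th, h (cos th) (sin th) = 0).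
    { intros th. apply Hbd; [exact Ht|]. unfold onS1; simpl.
      assert (E := sin2_cos2 th). unfold Rsqr in E. lra. }
    set (K := fun x y => M t x y + h (G1 t x y) (G2 t x y)).
    set (Kx := fun x y =>
      (axG t x y * G1x t x y + ayG t x y * G2x t x y) * G1t t x y + aG t x y * G1tx t x y
      + ((bxG t x y * G1x t x y + byG t x y * G2x t x y) * G2t t x y + bG t x y * G2tx t x y)
      + (hx (G1 t x y) (G2 t x y) * G1x t x y + hy (G1 t x y) (G2 t x y) * G2x t x y)).
    set (Ky := fun x y =>
      (axG t x y * G1y t x y + ayG t x y * G2y t x y) * G1t t x y + aG t x y * G1ty t x y
      + ((bxG t x y * G1y t x y + byG t x y * G2y t x y) * G2t t x y + bG t x y * G2ty t x y)
      + (hx (G1 t x y) (G2 t x y) * G1y t x y + hy (G1 t x y) (G2 t x y) * G2y t x y)).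
    assert (cK : cont3 (fun _ => K)) by (unfold K; cont3_tac).
    assert (cKx : cont3 (fun _ => Kx)) by (unfold Kx; cont3_tac).
    assert (cKy : cont3 (fun _ => Ky)) by (unfold Ky; cont3_tac).
    assert (dKx : forall x y, is_derive (fun s => K s y) x (Kx x y)).
    { intros x y. apply (is_derive_plus (V := R_NormedModule));
        [apply (is_derive_plus (V := R_NormedModule))|].
      - now apply (is_derive_mult_R (fun s => aG t s y) (fun s => G1t t s y)).
      - now apply (is_derive_mult_R (fun s => bG t s y) (fun s => G2t t s y)).
      - now apply (is_derive_comp2 h hx hy (fun s => G1 t s y) (fun s => G2 t s y)). }
    assert (dKy : forall x y, is_derive (fun s => K x s) y (Ky x y)).
    { intros x y. apply (is_derive_plus (V := R_NormedModule));
        [apply (is_derive_plus (V := R_NormedModule))|].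
      - now apply (is_derive_mult_R (fun s => aG t x s) (fun s => G1t t x s)).
      - now apply (is_derive_mult_R (fun s => bG t x s) (fun s => G2t t x s)).
      - now apply (is_derive_comp2 h hx hy (fun s => G1 t x s) (fun s => G2 t x s)). }
    (* As X_t = (hy, - hx), this is h + eta (X_t) on the target side, so f o G_t agrees with [K] on
       D and its integral is invariant under G_t. *)
    set (f := fun x y => h x y + a (x, y) * hy x y - b (x, y) * hx x y).
    assert (Kf : Cn 1 (fun _ => f)).
    { assert (neg : Cn 1 (fun _ x y => -1 * b (x, y))) by (apply Cn_mult; [apply Cn_const|exact Kb]).
      replace (fun _ : R => f) with
        (fun _ x y : R => h x y + a (x, y) * hy x y + -1 * b (x, y) * hx x y).
      - apply Cn_plus; [apply Cn_plus|].
        + apply (smooth3_Cn 1 _ (HH t Ht)).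
        + now apply (Cn_mult 1 (fun _ x y => a (x, y)) (fun _ => hy)).
        + now apply (Cn_mult 1 (fun _ x y => -1 * b (x, y)) (fun _ => hx)).
      - extensionality u. extensionality x. extensionality y. unfold f. ring. }
    assert (fr : forall F, Cn 2 F -> Cn 2 (fun _ => F t)).
    { intros F HF. apply (Cn_comp 2 F (fun _ _ _ => t) (fun _ x _ => x) (fun _ _ y => y));
        [exact HF|apply Cn_const|apply Cn_x|apply Cn_y]. }
    assert (Ef : int_D (fun p => f (G1 t (fst p) (snd p)) (G2 t (fst p) (snd p)))
                 = 2 * int_D (H t)).
    { rewrite (int_D_comp f (G1 t) (G2 t) (Psi t) Kf (fr _ HG1) (fr _ HG2) (HPth t) (Hdeg t Ht)
                 (fun th => Hlift t th Ht) (fun p => Hjac t p Ht)).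
      unfold f. rewrite (int_D_hamiltonian (fun x y => a (x, y)) (fun x y => b (x, y)) h hx hy)
        by (try assumption; intros x y; apply (Hd (x, y))).
      f_equal. }
    assert (cfG : cont3 (fun _ x y => f (G1 t x y) (G2 t x y))).
    { assert (cf := Cn_cont3 _ _ Kf). cont3_tac. }
    (* The coefficient of d (K eta). On D it equals that of dK /\ eta plus K, so the integrand [k']
       is L - K. *)
    pose (L := fun x y => Kx x y * b (x, y) + K x y * bx x y - (Ky x y * a (x, y) + K x y * ay x y)).
    assert (cL : cont3 (fun _ => L)) by (unfold L; cont3_tac).
    transitivity (1 * int_D (fun p => L (fst p) (snd p))
      + -1 * int_D (fun p => f (G1 t (fst p) (snd p)) (G2 t (fst p) (snd p)))).
    { rewrite <- (int_D_lin L (fun x y => f (G1 t x y) (G2 t x y))) by assumption.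
      apply int_D_ext. intros x y Hxy. apply Rlt_le in Hxy. fold (inD (x, y)) in Hxy.
      change (k' t x y = 1 * L x y + -1 * f (G1 t x y) (G2 t x y)).
      (* The condition d eta = omega is used at the point for d (K eta), and at its image for
         Cartan's formula, where the contraction of X_t with d eta must equal dH_t. *)
      assert (Q1 := curl x y Hxy). assert (Q2 := curl _ _ (HD t x y Ht Hxy)).
      unfold k', L, f, Kx, Ky, K, Pt, Qt, M, bxG.
      rewrite hamx, hamy, Q1, Q2 by exact Hxy. unfold aG, bG, axG, ayG, byG. ring. }
    rewrite Ef. unfold L.
    rewrite (green_disk (fun x y => K x y * a (x, y)) (fun x y => K x y * b (x, y))
       (fun x y => Ky x y * a (x, y) + K x y * ay x y)
       (fun x y => Kx x y * b (x, y) + K x y * bx x y)); try cont3_tac.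
    - rewrite (RInt_ext_R _ (fun th => m 0 th t * c th)).
      + unfold B. ring.
      + intros th. unfold m, c, circle_form, K.
        destruct (Hlift t th Ht) as [-> ->]. rewrite hS1. ring.
    - intros x y. now apply (is_derive_mult_R (fun z => K z y) (fun z => b (z, y))).
    - intros x y. now apply (is_derive_mult_R (fun z => K x z) (fun z => a (x, z))). }
  assert (iB : ex_RInt B 0 1) by now apply ex_RInt_cont.
  assert (iT : ex_RInt T' 0 1) by now apply ex_RInt_cont.
  (* On [0, 1] the space integral of [H t] is (B - T') / 2, a continuous function of t. This is how
     its integrability in time is obtained. *)
  assert (ER : Rcal H = / 2 * (RInt B 0 1 - RInt T' 0 1)).
  { unfold Rcal. transitivity (RInt (fun t => scal (/ 2) (minus (B t) (T' t))) 0 1).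
    - apply RInt_ext. intros t Ht. rewrite Rmin_left, Rmax_right in Ht by lra.
      rewrite HT' by lra. unfold scal, minus, plus, opp; simpl; unfold mult; simpl.
      eq_R. field.
    - rewrite (RInt_scal (V := R_CompleteNormedModule));
        [|now apply (ex_RInt_minus (V := R_NormedModule))].
      rewrite (RInt_minus (V := R_CompleteNormedModule)) by assumption. reflexivity. }
  enough (EB : RInt B 0 1 = RInt (fun th => RInt c (Psi 0 th) (Psi 1 th) * c th) 0 (2 * PI)).
  { rewrite <- EB, ER. lra. }
  rewrite (RInt_derive_R S B) by assumption.
  assert (S0 : S 0 = 0).
  { unfold S. rewrite (RInt_ext_R _ (fun _ => 0)).
    - rewrite RInt_const. unfold scal; simpl; unfold mult; simpl. ring.
    - intros th. unfold vprim. rewrite RInt_point. unfold zero; simpl. ring. }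
  rewrite S0, Rminus_0_r. apply RInt_ext_R. intros th. f_equal.
  unfold c, circle_form.
  (* For fixed th the time integral of [M] is the line integral of eta along the trajectory of the
     boundary point th. *)
  rewrite <- (line_integral_lift (fun t => G1 t (cos th) (sin th)) (fun t => G2 t (cos th) (sin th))
    (fun t => G1t t (cos th) (sin th)) (fun t => G2t t (cos th) (sin th)) (fun t => Psi t th) 0 1
    ltac:(lra)) with (P := fun x y => a (x, y)) (Q := fun x y => b (x, y)); auto.
  - intros t. apply (cont3_slice_t G1t), c1t.
  - intros t. apply (cont3_slice_t G2t), c2t.
Qed.

End Isotopy.

(** * Iterates of the time-one map *)

(** The first derivatives in [tau] are evaluated in the open disk, where agreement on D is agreement
    on a neighbourhood. *)
Lemma tau_ext (a b : R * R -> R) (g g' : R * R -> R * R) :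
  (forall p, inD p -> g p = g' p) -> tau a b g = tau a b g'.
Proof.
  intros Hg. apply int_D_ext. intros x y Hxy.
  assert (Lx : locally x (fun s => g (s, y) = g' (s, y))).
  { assert (C : continuous (fun s => s ^ 2 + y ^ 2) x).
    { apply (ex_derive_continuous (V := R_NormedModule)). auto_derive. exact I. }
    apply (filter_imp (fun s => s ^ 2 + y ^ 2 < 1)).
    - intros s Hs. apply Hg. apply Rlt_le, Hs.
    - apply (C (fun r => r < 1)). now apply open_lt. }
  assert (Ly : locally y (fun s => g (x, s) = g' (x, s))).
  { assert (C : continuous (fun s => x ^ 2 + s ^ 2) y).
    { apply (ex_derive_continuous (V := R_NormedModule)). auto_derive. exact I. }
    apply (filter_imp (fun s => x ^ 2 + s ^ 2 < 1)).
    - intros s Hs. apply Hg. apply Rlt_le, Hs.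
    - apply (C (fun r => r < 1)). now apply open_lt. }
  assert (E : g (x, y) = g' (x, y)) by (apply Hg, Rlt_le, Hxy).
  assert (E1 : dx (comp1 g) (x, y) = dx (comp1 g') (x, y)).
  { exact (Derive_ext_loc _ _ _ (filter_imp _ _ (fun s E => f_equal fst E) Lx)). }
  assert (E2 : dx (comp2 g) (x, y) = dx (comp2 g') (x, y)).
  { exact (Derive_ext_loc _ _ _ (filter_imp _ _ (fun s E => f_equal snd E) Lx)). }
  assert (E3 : dy (comp1 g) (x, y) = dy (comp1 g') (x, y)).
  { exact (Derive_ext_loc _ _ _ (filter_imp _ _ (fun s E => f_equal fst E) Ly)). }
  assert (E4 : dy (comp2 g) (x, y) = dy (comp2 g') (x, y)).
  { exact (Derive_ext_loc _ _ _ (filter_imp _ _ (fun s E => f_equal snd E) Ly)). }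
  now rewrite E, E1, E2, E3, E4.
Qed.

Lemma jac_det_comp (f1 f2 g1 g2 : R -> R -> R) (p : R * R) :
  Cn 1 (fun _ => f1) -> Cn 1 (fun _ => f2) -> Cn 1 (fun _ => g1) -> Cn 1 (fun _ => g2) ->
  jac_det (fun p => (f1 (g1 (fst p) (snd p)) (g2 (fst p) (snd p)),
                     f2 (g1 (fst p) (snd p)) (g2 (fst p) (snd p)))) p
  = jac_det (fun p => (f1 (fst p) (snd p), f2 (fst p) (snd p)))
      (g1 (fst p) (snd p), g2 (fst p) (snd p))
    * jac_det (fun p => (g1 (fst p) (snd p), g2 (fst p) (snd p))) p.
Proof.
  intros Hf1 Hf2 Hg1 Hg2. destruct p as [x y].
  destruct (C1_partials f1 Hf1) as (f1x & f1y & d1x & d1y & _ & c1x & _).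
  destruct (C1_partials f2 Hf2) as (f2x & f2y & d2x & d2y & _ & c2x & _).
  destruct (C1_partials g1 Hg1) as (g1x & g1y & e1x & e1y & _).
  destruct (C1_partials g2 Hg2) as (g2x & g2y & e2x & e2y & _).
  unfold jac_det, dx, dy, comp1, comp2. simpl.
  rewrite_Derive (is_derive_comp2 f1 f1x f1y _ _ x _ _ d1x d1y c1x (e1x x y) (e2x x y)).
  rewrite_Derive (is_derive_comp2 f1 f1x f1y _ _ y _ _ d1x d1y c1x (e1y x y) (e2y x y)).
  rewrite_Derive (is_derive_comp2 f2 f2x f2y _ _ x _ _ d2x d2y c2x (e1x x y) (e2x x y)).
  rewrite_Derive (is_derive_comp2 f2 f2x f2y _ _ y _ _ d2x d2y c2x (e1y x y) (e2y x y)).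
  set (u := g1 x y). set (v := g2 x y).
  rewrite_Derive (d1x u v). rewrite_Derive (d1y u v).
  rewrite_Derive (d2x u v). rewrite_Derive (d2y u v).
  rewrite_Derive (e1x x y). rewrite_Derive (e1y x y).
  rewrite_Derive (e2x x y). rewrite_Derive (e2y x y).
  unfold u, v. ring.
Qed.

Section Iterates.

Variables (F : R -> R * R -> R * R) (H : R -> R * R -> R) (Phi : R -> R -> R) (a b : R * R -> R).
Hypotheses (HF : is_symp_isotopy F) (HH : is_normalized_hamiltonian F H)
  (HPhi : is_boundary_lift F Phi) (Hab : is_primitive_omega a b).

Let F1 t x y := fst (F t (x, y)).
Let F2 t x y := snd (F t (x, y)).
Let it n := Nat.iter n (F 1).
Let it1 n x y := fst (it n (x, y)).
Let it2 n x y := snd (it n (x, y)).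

Lemma F_pair t p : F t p = (F1 t (fst p) (snd p), F2 t (fst p) (snd p)).
Proof. unfold F1, F2. now rewrite <- !surjective_pairing. Qed.

Lemma it_S n x y : it (S n) (x, y) = F 1 (it1 n x y, it2 n x y).
Proof. unfold it1, it2. now rewrite <- surjective_pairing. Qed.

Lemma F1_Cn n : Cn n F1.
Proof. destruct HF as [H1 _]. now apply smooth3_Cn. Qed.

Lemma F2_Cn n : Cn n F2.
Proof. destruct HF as [_ [H2 _]]. now apply smooth3_Cn. Qed.

Lemma iter_Cn k n : Cn k (fun _ => it1 n) /\ Cn k (fun _ => it2 n).
Proof.
  induction n as [|n [IH1 IH2]].
  - split; [apply Cn_x|apply Cn_y].
  - split.
    + replace (fun _ : R => it1 (S n)) with (fun _ x y : R => F1 1 (it1 n x y) (it2 n x y)).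
      * apply (Cn_comp k F1 (fun _ _ _ => 1) (fun _ => it1 n) (fun _ => it2 n));
          [apply F1_Cn|apply Cn_const|exact IH1|exact IH2].
      * extensionality u. extensionality x. extensionality y.
        unfold it1 at 2. now rewrite it_S.
    + replace (fun _ : R => it2 (S n)) with (fun _ x y : R => F2 1 (it1 n x y) (it2 n x y)).
      * apply (Cn_comp k F2 (fun _ _ _ => 1) (fun _ => it1 n) (fun _ => it2 n));
          [apply F2_Cn|apply Cn_const|exact IH1|exact IH2].
      * extensionality u. extensionality x. extensionality y.
        unfold it2 at 2. now rewrite it_S.
Qed.

Lemma F_inD t p : 0 <= t <= 1 -> inD p -> inD (F t p).
Proof. intros Ht. destruct HF as [_ [_ [_ HS]]]. now apply HS. Qed.

Lemma iter_inD n p : inD p -> inD (it n p).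
Proof.
  intros Hp. induction n as [|n IH]; [exact Hp|]. apply F_inD; [lra|exact IH].
Qed.

Lemma F_slice_C1 t : Cn 1 (fun _ => F1 t) /\ Cn 1 (fun _ => F2 t).
Proof.
  split; [apply (Cn_comp 1 F1 (fun _ _ _ => t) (fun _ x _ => x) (fun _ _ y => y))
         |apply (Cn_comp 1 F2 (fun _ _ _ => t) (fun _ x _ => x) (fun _ _ y => y))];
    first [apply F1_Cn|apply F2_Cn|apply Cn_const|apply Cn_x|apply Cn_y].
Qed.

(** Area preservation of the n-th iterate is a premise because [jac_iter] uses the case t = 1 as its
    own induction step. *)
Lemma jac_F_iter n : (forall p, inD p -> jac_det (it n) p = 1) ->
  forall t p, 0 <= t <= 1 -> inD p ->
  jac_det (fun p => (F1 t (it1 n (fst p) (snd p)) (it2 n (fst p) (snd p)),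
                     F2 t (it1 n (fst p) (snd p)) (it2 n (fst p) (snd p)))) p = 1.
Proof.
  intros Hn t p Ht Hp. destruct (F_slice_C1 t) as [f1 f2]. destruct (iter_Cn 1 n) as [i1 i2].
  rewrite jac_det_comp by assumption.
  assert (En : (fun p => (it1 n (fst p) (snd p), it2 n (fst p) (snd p))) = it n).
  { extensionality q. unfold it1, it2. now rewrite <- !surjective_pairing. }
  assert (Ep := equal_f En p). cbv beta in Ep. rewrite Ep, En.
  assert (Et : (fun p => (F1 t (fst p) (snd p), F2 t (fst p) (snd p))) = F t).
  { extensionality q. now rewrite <- F_pair. }
  rewrite Et, Hn by exact Hp.
  destruct HF as [_ [_ [_ HS]]]. destruct (HS t Ht) as [_ [_ [_ HJ]]].
  rewrite HJ; [ring|]. now apply iter_inD.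
Qed.

Lemma jac_iter n : forall p, inD p -> jac_det (it n) p = 1.
Proof.
  induction n as [|n IH]; intros p Hp.
  - unfold jac_det, dx, dy, comp1, comp2, it; simpl.
    rewrite !Derive_id, !Derive_const. ring.
  - rewrite <- (jac_F_iter n IH 1 p ltac:(lra) Hp). f_equal.
    extensionality q. destruct q as [x y]. rewrite it_S. apply F_pair.
Qed.

Lemma iter_lift n th : it n (cos th, sin th)
  = (cos (Nat.iter n (Phi 1) th), sin (Nat.iter n (Phi 1) th)).
Proof.
  destruct HPhi as [_ [_ HL]].
  induction n as [|n IH]; [reflexivity|].
  change (F 1 (it n (cos th, sin th))
          = (cos (Phi 1 (Nat.iter n (Phi 1) th)), sin (Phi 1 (Nat.iter n (Phi 1) th)))).
  rewrite IH. apply HL. lra.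
Qed.

Lemma Phi_continuous_t t th : continuous (fun s => Phi s th) t.
Proof.
  destruct HPhi as [HC _].
  apply (continuous_comp_2 (fun s => s) (fun _ => th) Phi t);
    [apply continuous_id|apply continuous_const|apply HC].
Qed.

Lemma Phi_continuous_th t th : continuous (Phi t) th.
Proof.
  destruct HPhi as [HC _].
  apply (continuous_comp_2 (fun _ => t) (fun s => s) Phi th);
    [apply continuous_const|apply continuous_id|apply HC].
Qed.

(** As functions of time, both sides lift the path of the same boundary point; their difference
    keeps its initial value 2 PI. *)
Lemma Phi_shift t th : 0 <= t <= 1 -> Phi t (th + 2 * PI) = Phi t th + 2 * PI.
Proof.
  intros Ht. destruct HPhi as [_ [H0 HL]].
  assert (E := lift_unique (fun s => Phi s (th + 2 * PI)) (fun s => Phi s th) 0 t ltac:(lra)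
    (fun s => Phi_continuous_t s _) (fun s => Phi_continuous_t s _)).
  cbv beta in E. rewrite !H0 in E. enough (Phi t (th + 2 * PI) - Phi t th = th + 2 * PI - th) by lra.
  apply E. intros s Hs.
  assert (L1 := HL s (th + 2 * PI) ltac:(lra)). assert (L2 := HL s th ltac:(lra)).
  rewrite cos_plus, sin_plus, cos_2PI, sin_2PI, !Rmult_0_r, !Rmult_1_r, Rminus_0_r, Rplus_0_r in L1.
  rewrite L2 in L1. injection L1 as E1 E2. now split.
Qed.

(** Injectivity of F 1 on D gives x = y modulo 2 PI, and [Phi_shift] excludes a nonzero number of
    turns. *)
Lemma Phi_inj x y : Phi 1 x = Phi 1 y -> x = y.
Proof.
  intros Hxy. destruct HPhi as [_ [_ HL]]. destruct HF as [_ [_ [_ HS]]].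
  destruct (HS 1 ltac:(lra)) as [_ [_ [[g [_ Hg]] _]]].
  assert (C : forall th, inD (cos th, sin th)).
  { intros th. unfold inD; simpl. assert (E := sin2_cos2 th). unfold Rsqr in E. lra. }
  assert (E : (cos x, sin x) = (cos y, sin y)).
  { destruct (Hg _ (C x)) as [_ [<- _]]. destruct (Hg _ (C y)) as [_ [<- _]].
    rewrite !HL, Hxy by lra. reflexivity. }
  injection E as E1 E2.
  destruct (cos_sin_eq_mod x y E1 E2) as [k ->].
  rewrite (lift_shift_Z (Phi 1)) in Hxy by (intros; apply Phi_shift; lra).
  lra.
Qed.

(** Composing on the right with the fixed map g^n leaves the velocity field X_t unchanged, so the
    same [H] serves the path F t o g^n. Its boundary lift is Phi t o (Phi 1)^n. *)
Lemma tau_iter_step n :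
  tau a b (it (S n)) - tau a b (it n)
  = RInt (fun th => RInt (circle_form a b) (Nat.iter n (Phi 1) th) (Nat.iter (S n) (Phi 1) th)
                    * circle_form a b th) 0 (2 * PI)
    - 2 * Rcal H.
Proof.
  destruct (iter_Cn 2 n) as [i1 i2].
  assert (E := tau_isotopy (fun t x y => F1 t (it1 n x y) (it2 n x y))
    (fun t x y => F2 t (it1 n x y) (it2 n x y)) a b H
    (fun t th => Phi t (Nat.iter n (Phi 1) th))).
  assert (T0 : Cn 2 (fun t _ _ => t)).
  { split; [intros t x y; apply (continuous_comp fst fst); apply continuous_fst|].
    exists (fun _ _ _ => 1), (fun _ _ _ => 0), (fun _ _ _ => 0).
    split_Cn; [| | |apply Cn_const..]; intros;
      first [apply (is_derive_const (V := R_NormedModule))|apply (is_derive_id (K := R_AbsRing))]. }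
  assert (ps : forall x y, (it1 n x y, it2 n x y) = it n (x, y)).
  { intros x y. unfold it1, it2. now rewrite <- surjective_pairing. }
  rewrite (tau_ext a b (it (S n)) (fun p =>
    (F1 1 (it1 n (fst p) (snd p)) (it2 n (fst p) (snd p)),
     F2 1 (it1 n (fst p) (snd p)) (it2 n (fst p) (snd p))))).
  2:{ intros [x y] _. rewrite it_S. apply F_pair. }
  (* F 0 is the identity on D only, so the start of the path agrees with the iterate on D, not on
     the plane. *)
  rewrite (tau_ext a b (it n) (fun p =>
    (F1 0 (it1 n (fst p) (snd p)) (it2 n (fst p) (snd p)),
     F2 0 (it1 n (fst p) (snd p)) (it2 n (fst p) (snd p))))).
  2:{ intros [x y] Hp. unfold F1, F2. simpl. rewrite <- surjective_pairing, ps.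
      destruct HF as [_ [_ [HF0 _]]]. symmetry. apply HF0. now apply iter_inD. }
  rewrite E; clear E.
  - f_equal. apply RInt_ext_R. intros th. destruct HPhi as [_ [H0 _]]. now rewrite H0.
  - apply (Cn_comp 2 F1 (fun t _ _ => t) (fun _ => it1 n) (fun _ => it2 n)); auto; apply F1_Cn.
  - apply (Cn_comp 2 F2 (fun t _ _ => t) (fun _ => it1 n) (fun _ => it2 n)); auto; apply F2_Cn.
  - exact Hab.
  - intros t Ht. apply (HH t Ht).
  - intros t p Ht. apply (HH t Ht).
  - intros t x y Ht Hxy. unfold F1, F2. rewrite <- surjective_pairing, ps.
    apply F_inD; [exact Ht|]. now apply iter_inD.
  - intros t p Ht Hp. apply jac_F_iter; auto. apply jac_iter.
  - intros t x y Ht Hxy. unfold F1, F2. rewrite <- surjective_pairing, ps.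
    apply (HH t Ht). now apply iter_inD.
  - intros t th. apply Phi_continuous_t.
  - intros t th. apply (continuous_comp (Nat.iter n (Phi 1)) (Phi t));
      [|apply Phi_continuous_th].
    apply continuous_iter. intros; apply Phi_continuous_th.
  - intros t th Ht. unfold F1, F2. rewrite ps, iter_lift.
    destruct HPhi as [_ [_ HL]]. now rewrite HL.
  - intros t Ht. rewrite <- (Rplus_0_l (2 * PI)) at 1.
    rewrite iter_lift_per by (intros; apply Phi_shift; lra).
    now apply Phi_shift.
Qed.

Lemma tau_iter n :
  tau a b (it n)
  = RInt (fun th => RInt (circle_form a b) th (Nat.iter n (Phi 1) th) * circle_form a b th)
      0 (2 * PI) - 2 * INR n * Rcal H.
Proof.
  assert (cc : forall th, continuous (circle_form a b) th).
  { destruct Hab as [Ha [Hb _]]. intros. apply circle_form_continuous;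
      [apply (Cn_cont3 0), (smooth3_Cn 0 _ Ha)|apply (Cn_cont3 0), (smooth3_Cn 0 _ Hb)]. }
  assert (Ch : forall x y z, RInt (circle_form a b) x z
      = RInt (circle_form a b) x y + RInt (circle_form a b) y z).
  { intros x y z. symmetry.
    apply (RInt_Chasles (V := R_CompleteNormedModule)); now apply ex_RInt_cont. }
  assert (cI : forall u v, (forall x, continuous u x) -> (forall x, continuous v x) -> forall x,
     continuous (fun th => RInt (circle_form a b) (u th) (v th) * circle_form a b th) x).
  { intros u v Hu Hv x. apply (continuous_mult (K := R_AbsRing)); [|apply cc].
    apply (continuous_comp_2 u v (fun p q => RInt (circle_form a b) p q) x (Hu x) (Hv x)).
    apply (continuous_RInt (circle_form a b) (u x) (v x) (fun p q => RInt (circle_form a b) p q)).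
    apply filter_forall. intros z. apply (RInt_correct (V := R_CompleteNormedModule)).
    now apply ex_RInt_cont. }
  assert (ci : forall k x, continuous (Nat.iter k (Phi 1)) x).
  { intros k x. apply continuous_iter. intros; apply Phi_continuous_th. }
  induction n as [|n IH].
  - rewrite (RInt_ext_R _ (fun _ => 0)).
    + rewrite RInt_const. unfold scal; simpl; unfold mult; simpl.
      (* For the identity the integrand of tau is eta /\ eta = 0. *)
      transitivity (int_D (fun p => (fun _ _ => 0) (fst p) (snd p))).
      * apply int_D_ext. intros x y _.
        unfold dx, dy, comp1, comp2, it; simpl. rewrite !Derive_id, !Derive_const. ring.
      * rewrite (int_D_dy (fun _ _ => 0) (fun _ _ => 0)).
        -- rewrite (RInt_ext_R _ (fun _ => 0)) by (intros; ring).
           rewrite RInt_const. unfold scal; simpl; unfold mult; simpl. eq_R. ring.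
        -- intros. apply (is_derive_const (V := R_NormedModule)).
        -- apply (Cn_cont3 0), Cn_const.
        -- apply (Cn_cont3 0), Cn_const.
    + intros th. simpl. rewrite RInt_point. unfold zero; simpl. ring.
  - assert (E := tau_iter_step n).
    assert (E1 : RInt (fun th => RInt (circle_form a b) th (Nat.iter (S n) (Phi 1) th)
                          * circle_form a b th) 0 (2 * PI)
      = RInt (fun th => RInt (circle_form a b) th (Nat.iter n (Phi 1) th) * circle_form a b th)
          0 (2 * PI)
      + RInt (fun th => RInt (circle_form a b) (Nat.iter n (Phi 1) th) (Nat.iter (S n) (Phi 1) th)
                    * circle_form a b th) 0 (2 * PI)).
    { rewrite (RInt_ext_R _ (fun th => plus
        (RInt (circle_form a b) th (Nat.iter n (Phi 1) th) * circle_form a b th)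
        (RInt (circle_form a b) (Nat.iter n (Phi 1) th) (Nat.iter (S n) (Phi 1) th)
           * circle_form a b th))).
      - apply (RInt_plus (V := R_CompleteNormedModule)); apply ex_RInt_cont; apply cI; auto;
          intros; first [apply continuous_id|apply ci].
      - intros th. rewrite (Ch th (Nat.iter n (Phi 1) th)).
        unfold plus; simpl. ring. }
    rewrite E1, S_INR. lra.
Qed.

(* [C' = c] has mean slope 1/2, so the boundary term of [tau (g^n)] is
   [PI / 2 * Phi^n 0] up to a bounded error. *)
Lemma tau_iter_asymptotic : exists C, forall n,
  Rabs (tau a b (it n) - (PI / 2 * Nat.iter n (Phi 1) 0 - 2 * INR n * Rcal H)) <= C.
Proof.
  assert (Hpi := PI_RGT_0).
  set (c := circle_form a b).
  assert (cc : forall th, continuous c th).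
  { destruct Hab as [Ha [Hb _]]. intros. apply circle_form_continuous;
      [apply (Cn_cont3 0), (smooth3_Cn 0 _ Ha)|apply (Cn_cont3 0), (smooth3_Cn 0 _ Hb)]. }
  destruct (RInt_periodic_linear c PI cc (circle_form_periodic a b) (RInt_circle_form a b Hab))
    as [M HM].
  destruct (continuous_bounded c 0 (2 * PI) ltac:(lra) cc) as [N HN].
  (* Length of the interval, times deviation of the inner integral, times the bound on |c|. In the
     deviation, M comes from [RInt_periodic_linear] and PI is half the displacement bound 2 PI. *)
  exists ((2 * PI - 0) * ((M + PI) * N)). intros n.
  rewrite tau_iter. fold c.
  set (u := Nat.iter n (Phi 1) 0).
  assert (ci : forall x, continuous (Nat.iter n (Phi 1)) x).
  { intros x. apply continuous_iter. intros; apply Phi_continuous_th. }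
  assert (cI : forall x, continuous (fun th => RInt c th (Nat.iter n (Phi 1) th) * c th) x).
  { intros x. apply (continuous_mult (K := R_AbsRing)); [|apply cc].
    apply (continuous_comp_2 (fun th => th) (Nat.iter n (Phi 1)) (fun p q => RInt c p q) x
             (continuous_id x) (ci x)).
    apply (continuous_RInt c x (Nat.iter n (Phi 1) x) (fun p q => RInt c p q)).
    apply filter_forall. intros z. apply (RInt_correct (V := R_CompleteNormedModule)).
    now apply ex_RInt_cont. }
  assert (iu : ex_RInt (fun th => scal (u / 2) (c th)) 0 (2 * PI)).
  { apply (ex_RInt_scal (V := R_NormedModule)). now apply ex_RInt_cont. }
  assert (E : RInt (fun th => minus (RInt c th (Nat.iter n (Phi 1) th) * c th)
                                (scal (u / 2) (c th))) 0 (2 * PI)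
    = RInt (fun th => RInt c th (Nat.iter n (Phi 1) th) * c th) 0 (2 * PI) - PI / 2 * u).
  { rewrite (RInt_minus (V := R_CompleteNormedModule)); [|now apply ex_RInt_cont|exact iu].
    rewrite (RInt_scal (V := R_CompleteNormedModule)) by now apply ex_RInt_cont.
    unfold c at 3. rewrite RInt_circle_form by exact Hab.
    unfold minus, plus, opp, scal; simpl; unfold mult; simpl. eq_R. field. }
  match goal with |- Rabs ?z <= _ => replace z with
    (RInt (fun th => RInt c th (Nat.iter n (Phi 1) th) * c th) 0 (2 * PI) - PI / 2 * u) by ring end.
  rewrite <- E.
  apply abs_RInt_le_const; [lra| |].
  - apply (ex_RInt_minus (V := R_NormedModule)); [now apply ex_RInt_cont|exact iu].
  - intros th Hth. unfold minus, plus, opp, scal; simpl; unfold mult; simpl.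
    set (I := RInt c th (Nat.iter n (Phi 1) th)).
    replace (I * c th + - (u / 2 * c th)) with ((I - u / 2) * c th) by ring.
    rewrite Rabs_mult. apply Rmult_le_compat; try apply Rabs_pos; [|now apply HN].
    (* First the deviation of the primitive of c from slope 1/2, with the slope left as PI / (2 PI)
       to match [HM]; then half the difference between the displacements at th and at 0. *)
    replace (I - u / 2) with
      ((I - PI / (2 * PI) * (Nat.iter n (Phi 1) th - th))
       + / 2 * (Nat.iter n (Phi 1) th - th - u)) by (field; lra).
    eapply Rle_trans; [apply Rabs_triang|]. apply Rplus_le_compat; [apply HM|].
    rewrite Rabs_mult, Rabs_pos_eq by lra.
    assert (D := iter_displacement (Phi 1) (Phi_continuous_th 1)
      (fun x => Phi_shift 1 x ltac:(lra)) Phi_inj n th).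
    fold u in D. lra.
Qed.

End Iterates.

(** * Homogenization as a limit *)

Theorem theorem2p5 (F : R -> R * R -> R * R) (H : R -> R * R -> R)
    (Phi : R -> R -> R) (a b : R * R -> R) :
  is_symp_isotopy F ->
  is_normalized_hamiltonian F H ->
  is_boundary_lift F Phi ->
  is_primitive_omega a b ->
  exists rho : R,
    is_lim_seq (fun n => Nat.iter n (Phi 1) 0 / (2 * PI * INR n)) rho /\
    is_lim_seq (fun n => tau a b (fun p => Nat.iter n (F 1) p) / INR n)
               (PI ^ 2 * rho - 2 * Rcal H).
Proof.
  intros HF HH HPhi Hab. assert (Hpi := PI_RGT_0).
  destruct (translation_number_exists (Phi 1) (Phi_continuous_th F Phi HPhi 1)
    (fun x => Phi_shift F Phi HPhi 1 x ltac:(lra)) (Phi_inj F Phi HF HPhi)) as [rho Hrho].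
  exists rho. split; [exact Hrho|].
  destruct (tau_iter_asymptotic F H Phi a b HF HH HPhi Hab) as [C HC].
  assert (L0 : is_lim_seq (fun n => C / INR n) 0).
  { replace (Finite 0) with (Rbar_mult C (Rbar_inv p_infty)) by (simpl; f_equal; ring).
    apply is_lim_seq_scal_l. apply is_lim_seq_inv; [apply is_lim_seq_INR|discriminate]. }
  (* Dividing the asymptotic main term by n: PI / 2 times the lift is PI^2 times the lift measured
     in turns. *)
  set (v := fun n => PI ^ 2 * (Nat.iter n (Phi 1) 0 / (2 * PI * INR n)) - 2 * Rcal H).
  assert (Lv : is_lim_seq v (PI ^ 2 * rho - 2 * Rcal H)).
  { apply (is_lim_seq_minus' _ _ (PI ^ 2 * rho) (2 * Rcal H)).
    - apply (is_lim_seq_scal_l _ (PI ^ 2) rho Hrho).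
    - apply is_lim_seq_const. }
  (* The bounded error becomes C / n after division. Restricting to n >= 1 avoids dividing by zero
     and leaves the limit unchanged. *)
  assert (B : forall n, (1 <= n)%nat ->
    Rabs (tau a b (fun p => Nat.iter n (F 1) p) / INR n - v n) <= C / INR n).
  { intros n Hn. assert (P : 0 < INR n) by (apply lt_0_INR; lia).
    specialize (HC n).
    replace (tau a b (fun p => Nat.iter n (F 1) p) / INR n - v n)
      with ((tau a b (fun p => Nat.iter n (F 1) p)
             - (PI / 2 * Nat.iter n (Phi 1) 0 - 2 * INR n * Rcal H)) * / INR n)
      by (unfold v; field; lra).
    rewrite Rabs_mult, (Rabs_pos_eq (/ INR n)) by (left; now apply Rinv_0_lt_compat).
    apply Rmult_le_compat_r; [left; now apply Rinv_0_lt_compat|exact HC]. }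
  apply (is_lim_seq_le_le_loc (fun n => v n - C / INR n) _ (fun n => v n + C / INR n)).
  - exists 1%nat. intros n Hn. specialize (B n Hn). apply Rabs_le_between in B. lra.
  - rewrite <- (Rminus_0_r (PI ^ 2 * rho - 2 * Rcal H)). now apply is_lim_seq_minus'.
  - rewrite <- (Rplus_0_r (PI ^ 2 * rho - 2 * Rcal H)). now apply is_lim_seq_plus'.
Qed.
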